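(* Consider the plant $\dot x(t)=f(x(t),u(t),w(t))$, a fixed integer $\ell\ge 1$, a family of approximate discrete-time plant models $F^a_{T,h}$, and a family of control laws $u_{T,h}$, with the associated exact plant model $F^e_T$, single-rate approximate closed-loop family $x(k+1)=\mathcal{F}^a_{T,h}(x(k),w_T[k])$ and dual-rate exact closed-loop family $x(k+1)=\mathcal{F}^e_{T,h}(x(k),w_T[k])$, all as defined in the context. Assume that: (i) the family of single-rate approximate discrete-time models $x(k+1)=\mathcal{F}^a_{T,h}(x(k),w_T[k])$ is Lyapunov semiglobally practically integral input-to-state stable (Lyapunov-SP-iISS); (ii) $F^a_{T,h}$ is one-step consistent with $F^e_T$; (iii) $u_{T,h}$ is uniformly locally Lipschitz. Then the family of dual-rate exact discrete-time models $x(k+1)=\mathcal{F}^e_{T,h}(x(k),w_T[k])$ is semiglobally practically integral-input-to-state stable (SP-iISS).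
   Context: **Notation.** $|\cdot|$ is the Euclidean norm. A function $\rho:\mathbb{R}_{\ge 0}\to\mathbb{R}_{\ge 0}$ is positive definite ($\rho\in\mathcal{PD}$) if it is continuous, zero at zero and positive elsewhere. $\alpha\in\mathcal{K}$ if $\alpha\in\mathcal{PD}$ and $\alpha$ is strictly increasing; $\alpha\in\mathcal{K}_\infty$ if in addition $\alpha(s)\to+\infty$ as $s\to+\infty$. A continuous $\beta:\mathbb{R}_{\ge0}\times\mathbb{R}_{\ge0}\to\mathbb{R}_{\ge0}$ is in $\mathcal{KL}$ if $\beta(\cdot,s)\in\mathcal{K}$ for each $s\ge 0$, and for each $r\ge0$, $\beta(r,\cdot)$ is decreasing with $\lim_{s\to+\infty}\beta(r,s)=0$. For $w:\mathbb{R}_{\ge 0}\to\mathbb{R}^p$, $T>0$ and $k\in\mathbb{Z}_{\ge 0}$, $w_T[k]$ is the restriction of $w$ to $[kT,(k+1)T]$ (written $w_T$ when $k$ is not emphasized), and $|w_T|_\infty$ denotes the supremum norm of this restriction. For measurable $w$ and $\gamma\in\mathcal{K}$, $|w|_\gamma:=\int_0^{+\infty}\gamma(|w(s)|)\,ds$ and $|w|_\infty:=\sup_{t\ge0}|w(t)|$. $\mathcal{L}_\infty$ is the set of measurable $w$ with $|w|_\infty<+\infty$; $w\in\mathcal{L}_\gamma(r)$ means $|w|_\gamma<r$, and $w\in\mathcal{L}_\infty(r)$ means $|w|_\infty<r$. **Plant and sampling.** The plant is $\dot x(t)=f(x(t),u(t),w(t))$ with $x(t)\in\mathbb{R}^n$,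 $u(t)\in\mathbb{R}^m$, $w(t)\in\mathbb{R}^p$, where $f$ is locally Lipschitz, $f(0,0,0)=0$, and the disturbance $w$ is measurable and locally essentially bounded. The control is held constant on intervals of length $T>0$ (zero-order-hold period): $u(t)=u(kT)=:u(k)$ for $t\in[kT,(k+1)T)$, $k\in\mathbb{Z}_{\ge0}$; write $x(k):=x(kT)$. The state is measured with period $T_s=\ell T$, $\ell\ge1$ an integer. **Exact plant model.** $F^e_T(x(k),u(k),w_T[k]):=x(k)+\int_{kT}^{(k+1)T}f(x(\tau),u(k),w(\tau))\,d\tau$, where $x(\cdot)$ is the plant solution on $[kT,(k+1)T]$ from $x(kT)=x(k)$. **Approximate plant model.** A family of maps $x(k+1)=F^a_{T,h}(x(k),u(k),w_T[k])$, where $h$ is a parameter of the numerical integration. **Control laws and dual-rate controller.** $u_{T,h}:\mathbb{R}^n\to\mathbb{R}^m$ with $u_{T,h}(0)=0$. The dual-rate controller is $u(k)=u_{T,h}(x_c(k))$, where $x_c(k)=x(k)$ if $k=i\ell$ for some $i\in\mathbb{Z}_{\ge0}$, and $x_c(k)=F^a_{T,h}(x_c(k-1),u(k-1),0)$ otherwise (the disturbance argument being set to zero). The single-rate controller ($\ell=1$) is $u(k)=u_{T,h}(x(k))$. **Closed loops.** The single-rate approximate closed loop is $x(k+1)=\mathcal{F}^a_{T,h}(x(k),w_T[k]):=F^a_{T,h}(x(k),u_{T,h}(x(k)),w_T[k])$. The dual-rate exact closed loop, denoted $x(k+1)=\mathcal{F}^e_{T,h}(x(k),w_T[k])$, is $x(k+1)=F^e_T(x(k),u_{T,h}(x_c(k)),w_T[k])$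 with $x_c$ given by the dual-rate rule above (the dependence on $x_c(k)$ is suppressed in the notation). **One-step consistency.** $F^a_{T,h}$ is one-step consistent with $F^e_T$ if for any real numbers $(\Delta_x,\Delta_u,\Delta_w)$ there exist $\rho\in\mathcal{K}_\infty$ and $T^*>0$ such that for each fixed $T\in(0,T^* )$ there exists $h^*\in(0,T]$ such that $|F^e_T(x,u,w_T)-F^a_{T,h}(x,u,w_T)|\le T\rho(h)$ for all $x\in\mathbb{R}^n$, $u\in\mathbb{R}^m$, $w\in\mathcal{L}_\infty$ with $|x|\le\Delta_x$, $|u|\le\Delta_u$, $|w_T|_\infty\le\Delta_w$ and all $h\in(0,h^* )$. **Uniformly locally Lipschitz.** $u_{T,h}$ is uniformly locally Lipschitz if for any $\Delta_x>0$ there exist positive reals $T^*$ and $\tilde L$ such that for each fixed $T\in(0,T^* )$ there exists $h^*\in(0,T]$ such that $|u_{T,h}(x_2)-u_{T,h}(x_1)|\le\tilde L|x_2-x_1|$ for all $h\in(0,h^* )$ and all $x_1,x_2\in\mathbb{R}^n$ with $\max\{|x_1|,|x_2|\}\le\Delta_x$. **Lyapunov-SP-iISS.** The family $x(k+1)=\mathcal{F}^a_{T,h}(x(k),w_T[k])$ is Lyapunov-SP-iISS if there exist $\underline\alpha,\overline\alpha\in\mathcal{K}_\infty$, $\alpha\in\mathcal{PD}$ and $\hat\gamma\in\mathcal{K}$ such that: for any positive reals $(\Delta_1,\Delta_2,\Delta_3,\delta_1)$ there exist $T^*>0$ and $M>0$ such that for any fixed $T\in(0,T^* )$ there exists $h^*\in(0,T]$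 such that for all $h\in(0,h^* )$ there exists a continuous function $V_{T,h}:\mathbb{R}^n\to\mathbb{R}_{\ge0}$ such that for all $x\in\mathbb{R}^n$ with $|x|\le\Delta_1$ and all $w\in\mathcal{L}_\infty(\Delta_2)\cap\mathcal{L}_{\hat\gamma}(\Delta_3)$, $$\underline\alpha(|x|)\le V_{T,h}(x)\le\overline\alpha(|x|),$$ $$V_{T,h}(\mathcal{F}^a_{T,h}(x,w_T))-V_{T,h}(x)\le T\Big[-\alpha(|x|)+\frac1T\int_{kT}^{(k+1)T}\hat\gamma(|w(s)|)\,ds+\delta_1\Big]$$ (with $w_T=w_T[k]$, for every $k\in\mathbb{Z}_{\ge0}$); and moreover $|V_{T,h}(x_1)-V_{T,h}(x_2)|\le M|x_1-x_2|$ for all $x_1,x_2\in\mathbb{R}^n$ with $\max\{|x_1|,|x_2|\}\le\Delta_1$, all $T\in(0,T^* )$ and all $h\in(0,h^* )$. **SP-iISS.** The family $x(k+1)=\mathcal{F}^e_{T,h}(x(k),w_T[k])$ is SP-iISS if there exist $\alpha\in\mathcal{K}_\infty$, $\beta\in\mathcal{KL}$ and $\gamma\in\mathcal{K}$ such that for any positive reals $(\Delta_x,\Delta_{w_1},\Delta_{w_2},\delta)$ there exists $T^*>0$ such that for each $T\in(0,T^* )$ there exists $h^*\in(0,T]$ such that for all $w\in\mathcal{L}_\infty(\Delta_{w_1})\cap\mathcal{L}_\gamma(\Delta_{w_2})$, all $x(0)\in\mathbb{R}^n$ with $|x(0)|\le\Delta_x$ and all $h\in(0,h^* )$, each solution of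 the family exists and satisfies $$\alpha(|x(k)|)\le\beta(|x(0)|,kT)+\int_0^{kT}\gamma(|w(s)|)\,ds+\delta\qquad\text{for all }k\in\mathbb{Z}_{\ge0}.$$ *)

(* Defs.v *)
(* MathComp-Analysis.  Vectors of R^d are row vectors 'rV[R]_d.  Functions and
   signals on [0, +oo[ are total functions on R whose values on negative
   arguments are irrelevant. *)
From HB Require Import structures.
From mathcomp Require Import all_boot all_order all_algebra.
From mathcomp Require Import all_classical all_reals all_analysis.

Import Order.TTheory GRing.Theory Num.Theory.
Import numFieldNormedType.Exports.

Local Open Scope classical_set_scope.
Local Open Scope ring_scope.

(* The library norm `|x| on 'rV[R]_d is the sup norm, hence this definition. *)
Definition enorm {R : realType} {d : nat} (x : 'rV[R]_d) : R :=
  Num.sqrt (\sum_(i < d) x 0 i ^+ 2).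

Section ComparisonFunctions.
Context {R : realType}.

Definition classPD (r : R -> R) : Prop :=
  [/\ {within `[0, +oo[, continuous r},
      r 0 = 0 &
      forall s : R, 0 < s -> 0 < r s].

Definition classK (a : R -> R) : Prop :=
  classPD a /\ {in `[0, +oo[ &, {homo a : s t / s < t}}.

Definition classKoo (a : R -> R) : Prop :=
  classK a /\ a s @[s --> +oo] --> +oo.

(* "Decreasing" in the second argument is non-strict: b 0 s = 0 for all s. *)
Definition classKL (b : R -> R -> R) : Prop :=
  [/\ {within [set p : R * R | 0 <= p.1 /\ 0 <= p.2],
         continuous (fun p : R * R => b p.1 p.2)},
      forall s : R, 0 <= s -> classK (b^~ s),
      forall r : R, 0 <= r ->
        {in `[0, +oo[ &, {homo b r : s t /~ s <= t}} &
      forall r : R, 0 <= r -> b r s @[s --> +oo] --> 0].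

End ComparisonFunctions.

(* R with the sigma-algebra of Lebesgue (not only Borel) measurable sets. *)
Definition lebesgueR (R : realType) :=
  caratheodory_type (@completed_lebesgue_measure R).

Section Signals.
Context {R : realType} {p : nat}.
Implicit Types (D : set R) (w : R -> 'rV[R]_p) (g : R -> R).

Definition measurable_signal w : Prop :=
  forall i, @measurable_fun _ _ (lebesgueR R) R `[0, +oo[ (fun t => w t 0 i).

Definition supnorm D w : \bar R :=
  ereal_sup [set (enorm (w t))%:E | t in D].

Definition gamma_norm g w : \bar R :=
  (\int[completed_lebesgue_measure]_(t in `[0%R, +oo[) (g (enorm (w t)))%:E)%E.

Definition Linf w : Prop :=
  measurable_signal w /\ (supnorm `[0%R, +oo[ w < +oo)%E.

Definition Linf_lt (r : R) w : Prop :=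
  measurable_signal w /\ (supnorm `[0%R, +oo[ w < r%:E)%E.

Definition Lgamma_lt g (r : R) w : Prop :=
  measurable_signal w /\ (gamma_norm g w < r%:E)%E.

Definition period (T : R) (k : nat) : set R := `[k%:R * T, k.+1%:R * T].

(* A segment records the index k together with a function on the k-th period,
   so that on_period T w k is w_T[k], the restriction of w to [kT, (k+1)T]. *)
Definition segment (T : R) : Type := {k : nat & period T k -> 'rV[R]_p}.

Definition on_period (T : R) w (k : nat) : segment T :=
  existT (fun k => period T k -> 'rV[R]_p) k (sigL (period T k) w).

End Signals.

Section Plant.
Context {R : realType} {n m p : nat}.
Variable f : 'rV[R]_n -> 'rV[R]_m -> 'rV[R]_p -> 'rV[R]_n.

(* Lipschitz constants refer to the sup norm, which is equivalent to enorm. *)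
Definition locally_lipschitz_field : Prop :=
  forall z : 'rV[R]_n * 'rV[R]_m * 'rV[R]_p,
  exists2 U, nbhs z U &
    [lipschitz (f y.1.1 y.1.2 y.2) | y in U].

Definition vintegral (D : set R) (g : R -> 'rV[R]_n) : 'rV[R]_n :=
  \row_i \int[completed_lebesgue_measure]_(t in D) g t 0 i.

Definition vintegrable (D : set R) (g : R -> 'rV[R]_n) : Prop :=
  forall i, completed_lebesgue_measure.-integrable D (fun t => (g t 0 i)%:E).

(* Caratheodory solution on [a, b] under constant control u. *)
Definition plant_solution (a b : R) (u : 'rV[R]_m) (w : R -> 'rV[R]_p)
    (phi : R -> 'rV[R]_n) : Prop :=
  [/\ {within `[a, b], continuous phi},
      vintegrable `[a, b] (fun t => f (phi t) u (w t)) &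
      forall t, t \in `[a, b] ->
        phi t = phi a + vintegral `[a, t] (fun s => f (phi s) u (w s))].

(* The graph of F^e_T: "F^e_T(x, u, w_T[k]) is defined and equal to y".
   A relation, because the plant may blow up before the end of the period. *)
Definition exact_model (T : R) (x : 'rV[R]_n) (u : 'rV[R]_m)
    (w : R -> 'rV[R]_p) (k : nat) (y : 'rV[R]_n) : Prop :=
  exists phi : R -> 'rV[R]_n,
    [/\ plant_solution (k%:R * T) (k.+1%:R * T) u w phi,
        phi (k%:R * T) = x &
        y = x + vintegral (period T k) (fun t => f (phi t) u (w t))].

End Plant.

Section Models.
Context {R : realType} {n m p : nat}.
Variable f : 'rV[R]_n -> 'rV[R]_m -> 'rV[R]_p -> 'rV[R]_n.
Variable Fa :
  forall T h : R, 'rV[R]_n -> 'rV[R]_m -> segment (p := p) T -> 'rV[R]_n.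
Variable uc : R -> R -> 'rV[R]_n -> 'rV[R]_m.

Definition one_step_consistent : Prop :=
  forall Dx Du Dw : R,
  exists2 rho : R -> R, classKoo rho &
  exists2 Ts : R, 0 < Ts &
  forall T : R, 0 < T < Ts ->
  exists2 hs : R, 0 < hs <= T &
  forall (x : 'rV[R]_n) (u : 'rV[R]_m) (w : R -> 'rV[R]_p) (k : nat) (h : R),
    enorm x <= Dx -> enorm u <= Du ->
    Linf w -> (supnorm (period T k) w <= Dw%:E)%E ->
    0 < h < hs ->
    forall y, exact_model f T x u w k y ->
      enorm (y - Fa T h x u (on_period T w k)) <= T * rho h.

Definition uniformly_locally_lipschitz : Prop :=
  forall Dx : R, 0 < Dx ->
  exists Ts L : R,
  [/\ 0 < Ts, 0 < L &
  forall T : R, 0 < T < Ts ->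
  exists2 hs : R, 0 < hs <= T &
  forall h : R, 0 < h < hs ->
  forall x1 x2 : 'rV[R]_n, Num.max (enorm x1) (enorm x2) <= Dx ->
    enorm (uc T h x2 - uc T h x1) <= L * enorm (x2 - x1)].

Definition single_rate_approx (T h : R) (x : 'rV[R]_n) (wT : segment T) :
  'rV[R]_n := Fa T h x (uc T h x) wT.

Definition lyapunov_SP_iISS
    (F : forall T h : R, 'rV[R]_n -> segment (p := p) T -> 'rV[R]_n) : Prop :=
  exists al au a g : R -> R,
  [/\ classKoo al, classKoo au, classPD a, classK g &
  forall D1 D2 D3 d1 : R, 0 < D1 -> 0 < D2 -> 0 < D3 -> 0 < d1 ->
  exists Ts M : R,
  [/\ 0 < Ts, 0 < M &
  forall T : R, 0 < T < Ts ->
  exists2 hs : R, 0 < hs <= T &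
  forall h : R, 0 < h < hs ->
  exists V : 'rV[R]_n -> R,
  [/\ continuous V,
      forall x, 0 <= V x,
      forall (x : 'rV[R]_n) (w : R -> 'rV[R]_p),
        enorm x <= D1 -> Linf_lt D2 w -> Lgamma_lt g D3 w ->
        al (enorm x) <= V x <= au (enorm x) /\
        forall k : nat,
        V (F T h x (on_period T w k)) - V x <=
          T * (- a (enorm x)
               + T^-1 * (\int[completed_lebesgue_measure]_(s in period T k)
                           g (enorm (w s)))
               + d1) &
      forall x1 x2 : 'rV[R]_n, Num.max (enorm x1) (enorm x2) <= D1 ->
        `|V x1 - V x2| <= M * enorm (x1 - x2)]]].

(* x_c(k), as a function of the plant trajectory x(0), x(1), ... *)
Fixpoint controller_state (l : nat) (T h : R) (x : nat -> 'rV[R]_n) (k : nat)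
    : 'rV[R]_n :=
  if k is j.+1 then
    if (l %| k)%N then x k
    else let xc := controller_state l T h x j in
         Fa T h xc (uc T h xc) (on_period T (fun=> 0) j)
  else x 0%N.

(* A trajectory keeps going through every period: no finite escape time. *)
Definition dual_rate_exact (l : nat) (T h : R) (w : R -> 'rV[R]_p)
    (x : nat -> 'rV[R]_n) : Prop :=
  forall k : nat,
    exact_model f T (x k) (uc T h (controller_state l T h x k)) w k (x k.+1).

End Models.

(* [traj T h w x] says that x(0), x(1), ... is a trajectory of the family. *)
Definition SP_iISS {R : realType} {n p : nat}
    (traj : R -> R -> (R -> 'rV[R]_p) -> (nat -> 'rV[R]_n) -> Prop) : Prop :=
  exists (a : R -> R) (b : R -> R -> R) (g : R -> R),
  [/\ classKoo a, classKL b, classK g &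
  forall Dx Dw1 Dw2 d : R, 0 < Dx -> 0 < Dw1 -> 0 < Dw2 -> 0 < d ->
  exists2 Ts : R, 0 < Ts &
  forall T : R, 0 < T < Ts ->
  exists2 hs : R, 0 < hs <= T &
  forall (w : R -> 'rV[R]_p) (x0 : 'rV[R]_n) (h : R),
    Linf_lt Dw1 w -> Lgamma_lt g Dw2 w -> enorm x0 <= Dx -> 0 < h < hs ->
    (exists2 x, traj T h w x & x 0%N = x0) /\
    forall x, traj T h w x -> x 0%N = x0 ->
    forall k : nat,
      a (enorm (x k)) <=
        b (enorm (x 0%N)) (k%:R * T)
        + (\int[completed_lebesgue_measure]_(s in `[0, k%:R * T])
             g (enorm (w s)))
        + d].

(* Main.v *)
(* Put z(k) = V(x(k)) - S(k), where V is the Lyapunov function of the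
   single-rate approximate loop and S(k) is the integral of gamma(|w|) up to
   time kT.  Within one measurement period the predicted state x_c drifts from
   x by O(T), so by one-step consistency the dual-rate exact loop inherits the
   dissipation inequality of V up to an arbitrarily small multiple of T; as
   long as the state stays in a fixed ball, z decreases unless it is already
   small.  If z(k) <= S(k), then V(x(k)) <= 2 S(k).  Otherwise z has been
   decreasing and above S up to time k, so along the way V(x) lies between z(k)
   and 2 z(0), and on such an annulus alpha is at least nu1(z(k)) nu2(z(0)).
   Summing, k T nu1(z(k)) nu2(z(0)) / 2 <= z(0).  Since rho(s) = s nu1(s) <= s,
   measuring the state by rho(alpha_low(|x|) / 2) turns both cases into a KL
   term plus S(k), with the same gain gamma. *)
Require Import Defs.
From mathcomp Require Import all_boot all_order all_algebra.
From mathcomp Require Import all_classical all_reals all_analysis.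
From mathcomp Require Import measurable_realfun ring lra.

Import Order.TTheory GRing.Theory Num.Theory.
Import numFieldNormedType.Exports.

Local Open Scope classical_set_scope.
Local Open Scope ring_scope.

Set Implicit Arguments.
Unset Strict Implicit.
Unset Printing Implicit Defensive.

(** * Integrals for the completed Lebesgue measure *)

Section BoundedIntegral.
Context {d : measure_display} {T : measurableType d} {R : realType}.
Variable mu : {measure set T -> \bar R}.

(** Since alpha is only positive definite, the decrease of V has no uniform rate: it vanishes at
    zero and may vanish at infinity. The product form of the rate separates the two effects. The
    factor for small values depends on the current state and is absorbed by the output function,
    while the factor for large values depends only on the initial state and so gives an explicit KL
    function. The dissipation inequality and all plant estimates hold only on balls, and the exact
    model is a relation that may have no value. Hence the existence of the next state and the bound
    on the states support each other, and the argument runs over finite prefixes of a trajectory,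
    with radii that leave room for one more step. The constants follow the quantifiers: radii, then
    the Lipschitz constants of plant and control and the tolerated error [d1], then [M], which is
    uniform in [T], then [T], then [h]. Analysis is done in the sup norm; the factor [n + 1] bounds
    the Euclidean norm by it. *)

Lemma bounded_integrable (D : set T) (g : T -> R) (M : R) :
  measurable D -> (mu D < +oo)%E -> measurable_fun D g ->
  (forall t, D t -> `|g t| <= M) -> mu.-integrable D (fun t => (g t)%:E).
Proof.
move=> mD fD mg gM.
have M0 t : D t -> (`|(g t)%:E| <= M%:E)%E by move=> Dt; rewrite lee_fin gM.
apply/integrableP; split; first exact/measurable_EFinP.
apply: (@le_lt_trans _ _ (\int[mu]_(x in D) (cst M%:E x))%E).
  apply: ge0_le_integral => //.
  by apply/measurable_EFinP; apply: measurableT_comp.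
rewrite integral_cst// -(@fineK _ (mu D)) ?ge0_fin_numE//.
by rewrite -EFinM ltry.
Qed.

Lemma norm_Rintegral_le (D : set T) (g : T -> R) (M : R) :
  measurable D -> (mu D < +oo)%E -> mu.-integrable D (fun t => (g t)%:E) ->
  (forall t, D t -> `|g t| <= M) ->
  `|\int[mu]_(t in D) g t| <= M * fine (mu D).
Proof.
move=> mD fD ig gM.
apply: le_trans (le_normr_Rintegral mD ig) _.
rewrite -Rintegral_cst//.
apply: le_Rintegral => //; first exact: integrable_norm.
by apply: (@bounded_integrable _ _ `|M|).
Qed.

End BoundedIntegral.

(** The preimage of an open interval under [F] is a union of countably many boxes with rational
    centre and radius, and each box pulls back along [v] to a finite intersection of conditions on
    single coordinates. No sigma-algebra on vectors is involved, and the source may carry the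
    Lebesgue sets of [lebesgueR]. *)
Lemma measurable_fun_continuous_rV {d : measure_display} {T : measurableType d}
    {R : realType} (N : nat) (D : set T) (v : T -> 'rV[R]_N) (F : 'rV[R]_N -> R) :
  (forall i, measurable_fun D (fun t => v t 0 i)) -> continuous F ->
  measurable_fun D (F \o v).
Proof.
move=> mv cF mD; apply: (measurability _ (RGenOpens.measurableE R)) => //.
move=> /= _ [_ [a [b ->] <-]].
set U := `]a, b[%classic; have oU : open U by exact: interval_open.
pose c (q : 'rV[rat]_N * rat) : 'rV[R]_N := map_mx ratr q.1.
pose B q := [set t | D t /\ (ball (c q) (ratr q.2) `<=` F @^-1` U) /\
  0 < ratr q.2 :> R /\ forall i, `|v t 0 i - c q 0 i| < ratr q.2].
have ball_coord (x y : 'rV[R]_N) e : 0 < e ->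
    ball x e y <-> forall i, `|y 0 i - x 0 i| < e.
  move=> e0; split=> [[_ xy] i|xy]; first by rewrite distrC; exact: xy.
  by split => // i j; rewrite ord1 /ball/= distrC.
rewrite (_ : _ `&` _ = \bigcup_q B q); last first.
  apply/seteqP; split => [t [Dt Ut]|t [q _ [Dt [qU [q0 tq]]]]]; last first.
    by split=> //; apply: qU; apply/ball_coord.
  have /nbhs_ballP[e /= e0 eU] : nbhs (v t) (F @^-1` U).
    by apply: open_nbhs_nbhs; split => //; exact: open_comp.
  (* With radius below [e / 2] and centre within that radius of [v t], the rational box contains
     [v t] and lies in its ball of radius [e]. *)
  have [r] : exists r, ratr r \in `]0, e / 2[.
    by apply: rat_in_itvoo; rewrite divr_gt0.
  rewrite in_itv/= => /andP[r0 re].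
  have /choice[q qP] : forall i, exists q : rat,
      ratr q \in `](v t 0 i - ratr r), (v t 0 i + ratr r)[.
    move=> i; apply: rat_in_itvoo.
    by rewrite ltrD2l gtrN.
  pose qv : 'rV[rat]_N := \row_i q i.
  exists (qv, r) => //; split => //.
  have vq i : `|v t 0 i - c (qv, r) 0 i| < ratr r.
    rewrite /c !mxE ltr_distlC /=.
    by move: (qP i); rewrite in_itv/= => /andP[? ?]; apply/andP; split; lra.
  split; last by split.
  move=> y /ball_coord yq; apply: eU; apply/ball_coord => // i.
  rewrite (_ : _ - _ = (y 0 i - c (qv, r) 0 i) - (v t 0 i - c (qv, r) 0 i)); last by lra.
  rewrite (le_lt_trans (ler_normB _ _))//.
  rewrite (@lt_trans _ _ (ratr r + ratr r))//; last by lra.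
  by rewrite ltrD// yq.
apply: countable_bigcupT_measurable; first exact: countableP.
move=> q; rewrite /B.
have [qU|nqU] := pselect ((ball (c q) (ratr q.2) `<=` F @^-1` U) /\ 0 < ratr q.2 :> R); last first.
  rewrite (_ : [set _ | _] = set0)//; apply/seteqP; split=> // t /= [_ [? [? _]]].
  by apply: nqU.
rewrite (_ : [set _ | _] =
   D `&` \bigcap_i (D `&` (fun t => v t 0 i) @^-1` `](c q 0 i - ratr q.2), (c q 0 i + ratr q.2)[)).
  apply: measurableI => //; apply: fin_bigcap_measurable => //.
  by move=> i _; apply: mv.
apply/seteqP; split=> t /=.
  move=> [Dt [_ [_ tq]]]; split=> // i _; split => //=.
  by rewrite in_itv/=; move: (tq i); rewrite ltr_distlC => /andP[? ?]; apply/andP; split; lra.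
move=> [Dt tq]; split => //; split; first by case: qU.
split; first by case: qU.
move=> i; have [_ /=] := tq i I; rewrite in_itv/= ltr_distlC => /andP[? ?].
by apply/andP; split; lra.
Qed.

Section LebesgueSegment.
Context {R : realType}.
Local Notation mu := (@completed_lebesgue_measure R).

Lemma measurable_lebesgueR (A : set R) :
  measurable A -> @measurable _ (lebesgueR R) A.
Proof. exact: sub_caratheodory. Qed.

Lemma measurable_itv_lebesgueR (i : interval R) :
  @measurable _ (lebesgueR R) [set` i].
Proof. by apply: measurable_lebesgueR; exact: measurable_itv. Qed.

Lemma completed_measure_itvcc (a b : R) : a <= b -> mu `[a, b] = (b - a)%:E.
Proof.
move=> ab; rewrite -[LHS]/(lebesgue_measure `[a, b]%classic) lebesgue_measure_itv/= lte_fin.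
by case: ltgtP ab => // -> _; rewrite subrr.
Qed.


Lemma completed_measure_itvcc_lty (a b : R) : (mu `[a, b] < +oo)%E.
Proof.
have [ab|ba] := leP a b; first by rewrite completed_measure_itvcc// ltry.
by rewrite set_itv_ge ?bnd_simp -?ltNge// measure0.
Qed.

(** The two closed pieces overlap only in the null point [b], so the right one may be taken half
    open. *)
Lemma Rintegral_itvcc_split (g : R -> R) (a b c : R) : a <= b <= c ->
  mu.-integrable `[a, c] (fun t => (g t)%:E) ->
  \int[mu]_(t in `[a, c]) g t =
  \int[mu]_(t in `[a, b]) g t + \int[mu]_(t in `[b, c]) g t.
Proof.
move=> /andP[ab bc] ig.
have mI (i : interval R) := measurable_itv_lebesgueR i.
have sub (D : set (lebesgueR R)) : measurable D -> D `<=` `[a, c]%classic ->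
    mu.-integrable D (fun t => (g t)%:E).
  by move=> mD Dac; exact: integrableS ig.
have bE : [set` `[b, b]] = [set b] by rewrite set_itv1.
have -> : \int[mu]_(t in `[b, c]) g t = \int[mu]_(t in `]b, c]) g t.
  rewrite (_ : [set` `[b, c]] = [set` `[b, b]] `|` [set` `]b, c]]); last first.
    rewrite -itv_bndbnd_setU ?bnd_simp//.
  rewrite Rintegral_setU//.
  - rewrite [X in X + _](_ : _ = 0) ?add0r//.
    apply/normr0_eq0/le_anti; rewrite normr_ge0 andbT.
    have := @norm_Rintegral_le _ _ _ mu `[b, b] g `|g b|.
    have -> : fine (mu `[b, b]) = 0 by rewrite completed_measure_itvcc// subrr.
    rewrite mulr0; apply => //; first exact: completed_measure_itvcc_lty.
    + by apply: sub => // t; rewrite bE => ->; rewrite /= in_itv/= ab.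
    + by move=> t; rewrite bE => ->.
  - apply: sub; first exact: measurableU.
    move=> t [] /=; rewrite !in_itv/= => /andP[? ?]; apply/andP; split; lra.
  - apply/disj_setPS => t [] /=; rewrite !in_itv/= => /andP[? ?] /andP[? ?]; lra.
rewrite (_ : [set` `[a, c]] = [set` `[a, b]] `|` [set` `]b, c]]); last first.
  by rewrite -itv_bndbnd_setU ?bnd_simp.
rewrite Rintegral_setU//.
- rewrite -itv_bndbnd_setU ?bnd_simp//.
- apply/disj_setPS => t [] /=; rewrite !in_itv/= => /andP[? ?] /andP[? ?]; lra.
Qed.

End LebesgueSegment.

(** * Row vectors and their integrals *)

Section RowVectors.
Context {R : realType} {d : nat}.
Implicit Types x : 'rV[R]_d.

Lemma rV_norm_coord x i : `|x 0 i| <= `|x|.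
Proof.
rewrite [leRHS]/Num.norm/= mx_normrE; apply/bigmax_geP; right => /=.
by exists (0, i).
Qed.

Lemma rV_norm_le x M : 0 <= M -> (forall i, `|x 0 i| <= M) -> `|x| <= M.
Proof.
move=> M0 xM; rewrite [leLHS]/Num.norm/= mx_normrE.
by apply/bigmax_leP; split => // -[i j] _ /=; rewrite ord1.
Qed.

Lemma norm_le_enorm x : `|x| <= enorm x.
Proof.
apply: rV_norm_le => [|i]; first exact: sqrtr_ge0.
rewrite -sqrtr_sqr ler_wsqrtr// (bigD1 i)//= lerDl.
by apply: sumr_ge0 => j _; exact: sqr_ge0.
Qed.

Lemma enorm_le_norm x : enorm x <= (d%:R + 1) * `|x|.
Proof.
have c0 : 0 <= (d%:R + 1) * `|x| by rewrite mulr_ge0.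
rewrite -(ger0_norm c0) -sqrtr_sqr ler_wsqrtr//.
apply: (@le_trans _ _ (\sum_(i < d) `|x| ^+ 2)).
  apply: ler_sum => i _; rewrite -(real_normK (num_real _)).
  by rewrite lerXn2r ?nnegrE ?rV_norm_coord.
rewrite sumr_const card_ord exprMn -[leLHS]mulr_natl ler_wpM2r ?sqr_ge0//.
have : (0 : R) <= d%:R by []. nra.
Qed.

Lemma enorm_ge0 x : 0 <= enorm x.
Proof. exact: sqrtr_ge0. Qed.

Lemma enorm0 : enorm (0 : 'rV[R]_d) = 0.
Proof. by rewrite /enorm big1 ?sqrtr0// => i _; rewrite mxE expr0n. Qed.

Lemma enorm_continuous : continuous (@enorm R d).
Proof.
have cs (s : seq 'I_d) : continuous (fun x : 'rV[R]_d => \sum_(i <- s) x 0 i ^+ 2).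
  elim: s => [|i s IHs].
    rewrite (_ : (fun _ => _) = cst 0); first exact: cst_continuous.
    by apply/funext => x; rewrite big_nil.
  rewrite (_ : (fun _ => _) =
      (fun x : 'rV[R]_d => x 0 i * x 0 i) \+ (fun x => \sum_(j <- s) x 0 j ^+ 2)).
    by move=> x; apply: continuousD; [|exact: IHs];
      apply: continuousM; exact: coord_continuous.
  by apply/funext => x; rewrite big_cons expr2.
move=> x; apply: continuous_comp; last exact: sqrt_continuous.
exact: cs.
Qed.

Lemma continuous_rV (T : topologicalType) (g : T -> 'rV[R]_d) :
  (forall i, continuous (fun t => g t 0 i)) -> continuous g.
Proof.
move=> cg t; apply/cvgrPdist_lt => e e0.
have : \forall s \near t, forall i, `|g t 0 i - g s 0 i| < e / 2.
  apply: filter_forall => i.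
  by have /cvgrPdist_lt := cg i t; apply; rewrite divr_gt0.
apply: filterS => s gs; apply: (@le_lt_trans _ _ (e / 2)); last by lra.
by apply: rV_norm_le => [|i]; [lra|rewrite !mxE ltW].
Qed.

End RowVectors.

Section VectorIntegral.
Context {R : realType} {n : nat}.
Local Notation mu := (@completed_lebesgue_measure R).
Implicit Types g : R -> 'rV[R]_n.

Lemma vintegrableS (a b c e : R) g : a <= c -> e <= b ->
  vintegrable `[a, b] g -> vintegrable `[c, e] g.
Proof.
move=> ac eb ig i; apply: integrableS (ig i); try exact: measurable_itv_lebesgueR.
by move=> t; rewrite /= !in_itv/= => /andP[? ?]; apply/andP; split; lra.
Qed.

Lemma vintegral_norm_le (a b M : R) g : a <= b -> 0 <= M ->
  vintegrable `[a, b] g -> (forall t, a <= t <= b -> `|g t| <= M) ->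
  `|vintegral `[a, b] g| <= M * (b - a).
Proof.
move=> ab M0 ig gM; apply: rV_norm_le => [|i]; first by rewrite mulr_ge0// subr_ge0.
have <- : fine (mu `[a, b]) = b - a by rewrite completed_measure_itvcc.
rewrite mxE; apply: norm_Rintegral_le => //.
- exact: measurable_itv_lebesgueR.
- exact: completed_measure_itvcc_lty.
- move=> t; rewrite /= in_itv/= => /gM; apply: le_trans.
  exact: rV_norm_coord.
Qed.

Lemma vintegralB (a b : R) g1 g2 :
  vintegrable `[a, b] g1 -> vintegrable `[a, b] g2 ->
  vintegral `[a, b] g1 - vintegral `[a, b] g2 = vintegral `[a, b] (fun t => g1 t - g2 t).
Proof.
move=> i1 i2; apply/rowP => i; rewrite !mxE -RintegralB//.
- by apply: eq_Rintegral => t _; rewrite !mxE.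
- exact: measurable_itv_lebesgueR.
- exact: i1.
- exact: i2.
Qed.

Lemma vintegrableB (a b : R) g1 g2 :
  vintegrable `[a, b] g1 -> vintegrable `[a, b] g2 ->
  vintegrable `[a, b] (fun t => g1 t - g2 t).
Proof.
move=> i1 i2 i.
have mI := measurable_itv_lebesgueR `[a, b].
have := integrableB mI (i1 i) (i2 i); congr (_.-integrable _ _).
by apply/funext => t; rewrite !mxE.
Qed.

Lemma vintegral_split (a b c : R) g : a <= b <= c ->
  vintegrable `[a, c] g ->
  vintegral `[a, c] g = vintegral `[a, b] g + vintegral `[b, c] g.
Proof.
by move=> abc ig; apply/rowP => i; rewrite !mxE; exact: Rintegral_itvcc_split.
Qed.

Lemma vintegral_set1 (a : R) g : vintegrable `[a, a] g -> vintegral `[a, a] g = 0.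
Proof.
move=> ig; apply/normr0_eq0/le_anti; rewrite normr_ge0 andbT.
have := @vintegral_norm_le a a `|g a| g (lexx a) (normr_ge0 _) ig.
by rewrite subrr mulr0; apply => t /le_anti ->.
Qed.

End VectorIntegral.

(** * Comparison functions and signals *)

Section HalfLine.
Context {R : realType}.

Lemma continuous_within_comp {T U V : topologicalType} (D : set U) (r : U -> V)
    (h : T -> U) :
  {within D, continuous r} -> continuous h -> (forall x, D (h x)) ->
  continuous (r \o h).
Proof.
move=> /subspace_continuousP cr ch Dh x A /(cr _ (Dh x)) wA.
have := ch x _ wA; rewrite /nbhs/=; apply: filterS => y; apply; exact: Dh.
Qed.

Lemma classPD_continuous (r : R -> R) : classPD r -> continuous (fun s : R => r `|s|).
Proof.
case=> cr _ _; apply: (continuous_within_comp (h := fun s : R => `|s|) cr).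
  exact: norm_continuous.
by move=> x; rewrite /= in_itv/= andbT.
Qed.

Lemma classPD_ge0 (r : R -> R) s : classPD r -> 0 <= s -> 0 <= r s.
Proof.
by move=> [_ r0 rp]; rewrite le_eqVlt => /predU1P[<-|/rp/ltW//]; rewrite r0.
Qed.

Lemma classK_le (a : R -> R) s t : classK a -> 0 <= s -> s <= t -> a s <= a t.
Proof.
move=> [_ ha] s0; rewrite le_eqVlt => /predU1P[->//|st].
by apply/ltW/ha => //; rewrite in_itv/= andbT//; lra.
Qed.

Lemma classKoo_large (a : R -> R) (Y : R) : classKoo a ->
  exists2 X, 0 < X & forall s, X <= s -> Y <= a s.
Proof.
move=> [_ /cvgryPge/(_ Y)[X [_ XY]]].
exists (`|X| + 1) => [|s Xs]; first by rewrite ltr_pwDr.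
by apply: XY; apply: lt_le_trans Xs; rewrite (le_lt_trans (ler_norm _))// ltrDl.
Qed.

Lemma classPD_small (r : R -> R) (e : R) : classPD r -> 0 < e ->
  exists2 s0, 0 < s0 & forall s, 0 < s < s0 -> r s <= e.
Proof.
move=> rPD e0; have [_ r0 _] := rPD.
have /cvgrPdist_lt/(_ e e0)/nbhs_ballP[d /= d0 dr] := @classPD_continuous r rPD 0.
exists d => // s /andP[s0 sd].
have := dr s; rewrite /ball/= sub0r normrN normr0 r0 sub0r normrN !gtr0_norm//.
  by move=> /(_ sd)/ltW.
by case: rPD => _ _; apply.
Qed.

End HalfLine.

Section Signals.
Context {R : realType} {p : nat}.
Local Notation mu := (@completed_lebesgue_measure R).
Implicit Types w : R -> 'rV[R]_p.

Lemma Linf_lt_bound (r : R) w t : Linf_lt r w -> 0 <= t -> enorm (w t) < r.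
Proof.
move=> [_ wr] t0; rewrite -lte_fin; apply: le_lt_trans wr.
by apply: ereal_sup_ubound; exists t => //=; rewrite in_itv/= andbT.
Qed.

Lemma Linf_lt_Linf (r : R) w : Linf_lt r w -> Linf w.
Proof. by move=> [mw wr]; split=> //; apply: (lt_trans wr); rewrite ltry. Qed.

Lemma supnorm_le (D : set R) w (r : R) :
  (forall t, D t -> enorm (w t) <= r) -> (supnorm D w <= r%:E)%E.
Proof. by move=> wr; apply: ge_ereal_sup => _ [t Dt <-]; rewrite lee_fin wr. Qed.

Lemma Linf0 : Linf (fun=> 0 : 'rV[R]_p).
Proof.
split; first by move=> i; apply: measurable_cst.
apply: (@le_lt_trans _ _ 0%:E); last by rewrite ltry.
by apply: supnorm_le => t _; rewrite enorm0.
Qed.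

Lemma period_ge0 (T : R) k t : 0 <= T -> period T k t -> 0 <= t.
Proof.
move=> T0; rewrite /period/= in_itv/= => /andP[+ _]; apply: le_trans.
by rewrite mulr_ge0.
Qed.

Section Gain.
Variables (g : R -> R) (W : R) (w : R -> 'rV[R]_p).
Hypotheses (gK : classK g) (wW : Linf_lt W w).

Lemma gain_measurable :
  @measurable_fun _ _ (lebesgueR R) R `[0, +oo[ (fun t => g (enorm (w t))).
Proof.
have := @measurable_fun_continuous_rV _ (lebesgueR R) R p `[0, +oo[ w
  (fun x => g `|enorm x|).
rewrite /comp; under [X in measurable_fun _ X]eq_fun do
  rewrite (ger0_norm (enorm_ge0 _)).
apply; first by case: wW.
move=> x; apply: (@continuous_comp _ _ _ (@enorm R p) (fun s : R => g `|s|)).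
  exact: enorm_continuous.
exact: (classPD_continuous gK.1).
Qed.

Lemma gain_integrable (a b : R) : 0 <= a ->
  mu.-integrable `[a, b] (fun t => (g (enorm (w t)))%:E).
Proof.
move=> a0; have sub : `[a, b]%classic `<=` `[0, +oo[%classic.
  by move=> t; rewrite /= !in_itv/= => /andP[? _]; rewrite andbT; lra.
apply: (@bounded_integrable _ _ _ _ _ _ (g W)).
- exact: measurable_itv_lebesgueR.
- exact: completed_measure_itvcc_lty.
- apply: measurable_funS gain_measurable => //.
  exact: measurable_itv_lebesgueR.
- move=> t /sub; rewrite /= in_itv/= andbT => t0.
  rewrite ger0_norm; last by apply: (classPD_ge0 gK.1); exact: enorm_ge0.
  by apply: (classK_le gK); [exact: enorm_ge0|apply/ltW/(Linf_lt_bound wW)].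
Qed.

Definition gain_upto (t : R) := \int[mu]_(s in `[0, t]) g (enorm (w s)).

Lemma gain_ge0 (D : set R) : 0 <= \int[mu]_(s in D) g (enorm (w s)).
Proof.
by apply: Rintegral_ge0 => t _; apply: (classPD_ge0 gK.1); exact: enorm_ge0.
Qed.

Lemma gain_uptoS (T : R) k : 0 <= T ->
  gain_upto (k.+1%:R * T) =
  gain_upto (k%:R * T) + \int[mu]_(s in period T k) g (enorm (w s)).
Proof.
move=> T0; apply: Rintegral_itvcc_split; last exact: gain_integrable.
by rewrite mulr_ge0//= ler_wpM2r// ler_nat.
Qed.

Lemma gain_upto0 : gain_upto 0 = 0.
Proof.
(* Splitting the degenerate segment at 0 gives [I = I + I]. *)
have := @Rintegral_itvcc_split _ (fun t => g (enorm (w t))) 0 0 0.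
rewrite lexx => /(_ isT (gain_integrable _ (lexx 0))) /eqP.
by rewrite -subr_eq subrr eq_sym => /eqP.
Qed.

Lemma gain_upto_lt (r t : R) : Lgamma_lt g r w -> gain_upto t < r.
Proof.
move=> [_ wr]; have [t0|t0] := leP 0 t; last first.
  rewrite /gain_upto set_itv_ge ?bnd_simp -?ltNge// Rintegral_set0.
  rewrite -lte_fin; apply: le_lt_trans wr; apply: integral_ge0 => s _.
  by rewrite lee_fin (classPD_ge0 gK.1)// enorm_ge0.
rewrite -lte_fin; apply: le_lt_trans wr.
rewrite /gain_upto /Rintegral fineK; last first.
  apply: integrable_fin_num; first exact: measurable_itv_lebesgueR.
  exact: gain_integrable.
apply: ge0_subset_integral.
- exact: measurable_itv_lebesgueR.
- exact: measurable_itv_lebesgueR.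
- by apply/measurable_EFinP; exact: gain_measurable.
- by move=> s _; rewrite lee_fin (classPD_ge0 gK.1)// enorm_ge0.
- by move=> s; rewrite /= !in_itv/= => /andP[-> _].
Qed.

End Gain.
End Signals.

(** * Locally Lipschitz maps *)

Lemma lipschitz_continuous {R : realType} {V W : normedModType R} (phi : V -> W) (C : R) :
  (forall s t, `|phi s - phi t| <= C * `|s - t|) -> continuous phi.
Proof.
move=> lip t; apply/cvgrPdist_lt => e e0.
have C1 : 0 < `|C| + 1 by rewrite ltr_wpDl.
near=> s; rewrite (le_lt_trans (lip _ _))//.
have : `|t - s| < e / (`|C| + 1).
  near: s; apply: cvgr_dist_lt; first exact: cvg_id.
  by rewrite divr_gt0.
rewrite ltr_pdivlMr// => h; apply: le_lt_trans h.
by rewrite mulrC ler_wpM2l// (le_trans (ler_norm _))// lerDl.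
Unshelve. all: by end_near. Qed.

Section LipschitzOnCompact.
Context {R : realType} {V W : normedModType R}.
Variable F : V -> W.
Hypothesis F_lip : forall z : V, exists2 U, nbhs z U & [lipschitz F y | y in U].

Lemma locally_lipschitz_at (z : V) : exists U M,
  [/\ nbhs z U, 0 <= M &
      forall y1 y2, U y1 -> U y2 -> `|F y1 - F y2| <= M * `|y1 - y2| ].
Proof.
have [U zU [M [_ MU]]] := F_lip z.
exists U, (`|M| + 1); split=> //
  y1 y2 Uy1 Uy2.
have M1 : M < `|M| + 1 by rewrite (le_lt_trans (ler_norm _))// ltrDl.
exact: (MU _ M1 (y1, y2)).
Qed.

Lemma locally_lipschitz_continuous : continuous F.
Proof.
move=> z; apply/cvgrPdist_lt => e e0.
have [U [M [zU M0 UM]]] := locally_lipschitz_at z.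
have zz := nbhs_singleton zU.
near=> y.
have yU : U y by near: y.
rewrite (le_lt_trans (UM _ _ zz yU))//.
have zy : `|z - y| < e / (M + 1).
  near: y; apply: cvgr_dist_lt; first exact: cvg_id.
  by rewrite divr_gt0// ltr_wpDl.
have M1 : 0 < M + 1 by rewrite ltr_wpDl.
rewrite ltr_pdivlMr// in zy.
have : 0 <= `|z - y| by []. nra.
Unshelve. all: by end_near. Qed.

(** Local constants do not compare distant points of a set that need not be convex, so the covering
    is taken on the square of [A]. Near the diagonal the local constant works; near a pair at
    distance [e > 0] the increments of [F] are at most [m] and the distances at least [e / 2], so
    [2 * m / e] works. *)
Lemma locally_lipschitz_compact (A : set V) : compact A ->
  exists2 K, 0 < K &
    forall z1 z2, A z1 -> A z2 -> `|F z1 - F z2| <= K * `|z1 - z2|.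
Proof.
move=> cA.
pose P (K : R) (z : V * V) := `|F z.1 - F z.2| <= K * `|z.1 - z.2|.
suff : \forall K \near +oo, A `*` A `<=` P K.
  move=> [M [_ MP]]; exists (`|M| + 1); first by rewrite ltr_wpDl.
  move=> z1 z2 Az1 Az2; apply: (MP (`|M| + 1) _ (z1, z2)) => //.
  by rewrite (le_lt_trans (ler_norm _))// ltrDl.
have /compact_near_coveringP := compact_setX cA cA.
apply => -[z z'] _.
have [<-|zz'] := eqVneq z z'.
  have [U [M [zU M0 UM]]] := locally_lipschitz_at z.
  exists (U `*` U, [set K | M < K]) => /=.
    by split; [exists (U, U)|exists M; split=> //; exact: num_real].
  move=> [[y y'] K] /= [[Uy Uy'] MK]; rewrite /P/=.
  by rewrite (le_trans (UM _ _ Uy Uy'))// ler_wpM2r// ltW.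
have e0 : 0 < `|z - z'| by rewrite normr_gt0 subr_eq0.
pose e := `|z - z'|; rewrite -/e in e0.
have near1 (x : V) : nbhs x [set y | `|x - y| < e / 4 /\ `|F x - F y| < 1].
  apply: filterI; first by apply: cvgr_dist_lt; [exact: cvg_id|rewrite divr_gt0].
  by have /cvgrPdist_lt := @locally_lipschitz_continuous x; apply.
pose m := `|F z - F z'| + 2.
have m0 : 0 <= m by rewrite addr_ge0.
exists ([set y | `|z - y| < e / 4 /\ `|F z - F y| < 1] `*`
        [set y | `|z' - y| < e / 4 /\ `|F z' - F y| < 1], [set K | 2 * m / e < K]) => /=.
  split; last by exists (2 * m / e); split=> //; exact: num_real.
  by exists ([set y | `|z - y| < e / 4 /\ `|F z - F y| < 1],
        [set y | `|z' - y| < e / 4 /\ `|F z' - F y| < 1]).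
move=> [[y y'] K] /= [[[zy Fzy] [zy' Fzy']] mK]; rewrite /P/=.
have yy' : e / 2 <= `|y - y'|.
  have : e <= `|z - y| + `|y - y'| + `|z' - y'|.
    rewrite /e (_ : z - z' = (z - y) + (y - y') - (z' - y')).
      by rewrite (le_trans (ler_normB _ _))// lerD2r ler_normD.
    by rewrite opprB !subrKA.
  lra.
have Fyy' : `|F y - F y'| <= m.
  have : `|F y - F y'| <= `|F z - F y| + `|F z - F z'| + `|F z' - F y'|.
    rewrite (_ : F y - F y' = - (F z - F y) + (F z - F z') + (F z' - F y')).
      rewrite (le_trans (ler_normD _ _))// lerD2r.
      by rewrite (le_trans (ler_normD _ _))// normrN.
    by rewrite opprB !subrKA.
  rewrite /m; lra.
apply: (le_trans Fyy').
have K0 : 0 <= K by apply: ltW; apply: le_lt_trans mK; rewrite divr_ge0// ?mulr_ge0// ltW.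
apply: (@le_trans _ _ (K * (e / 2))); last by rewrite ler_wpM2l.
move: mK; rewrite ltr_pdivrMr//; lra.
Qed.

End LipschitzOnCompact.

Section Plant.
Context {R : realType} {n m p : nat}.
Variable f : 'rV[R]_n -> 'rV[R]_m -> 'rV[R]_p -> 'rV[R]_n.
Hypothesis f_lip : locally_lipschitz_field f.

Lemma norm_ball_compact d (B : R) : compact [set x : 'rV[R]_d | `|x| <= B].
Proof.
apply: bounded_closed_compact.
  exists B; split; first exact: num_real.
  by move=> M BM x /= xB; rewrite (le_trans xB)// ltW.
apply: (@closed_comp _ _ (fun x : 'rV[R]_d => `|x|) [set r | r <= B]).
  by move=> x _; exact: norm_continuous.
exact: closed_le.
Qed.

(** [K] serves twice: the bound on [f] is the Lipschitz estimate against the origin, where [f]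
    vanishes. *)
Lemma field_lipschitz (B : R) : f 0 0 0 = 0 -> exists2 K, 0 < K &
  (forall x1 x2 u1 u2 w, `|x1| <= B -> `|x2| <= B -> `|u1| <= B -> `|u2| <= B ->
    `|w| <= B -> `|f x1 u1 w - f x2 u2 w| <= K * (`|x1 - x2| + `|u1 - u2|)) /\
  (forall x u w, `|x| <= B -> `|u| <= B -> `|w| <= B -> `|f x u w| <= K * B).
Proof.
move=> f0; pose F (y : 'rV[R]_n * 'rV[R]_m * 'rV[R]_p) := f y.1.1 y.1.2 y.2.
have [K K0 FK] := locally_lipschitz_compact (F := F) f_lip
  (compact_setX (compact_setX (@norm_ball_compact n B) (@norm_ball_compact m B))
    (@norm_ball_compact p B)).
exists K => //; split=> [x1 x2 u1 u2 w x1B x2B u1B u2B wB|x u w xB uB wB].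
  apply: (le_trans (FK (x1, u1, w) (x2, u2, w) _ _)) => //.
  rewrite ler_wpM2l ?(ltW K0)//.
  rewrite !prod_normE/= subrr normr0 ge_max ge_max lerDl lerDr !normr_ge0/=.
  by rewrite addr_ge0.
have B0 : 0 <= B by exact: le_trans xB.
have F0 : F 0 = 0 by exact: f0.
have zB : `|(x, u, w)| <= B by rewrite !prod_normE/= !ge_max xB uB wB.
have := FK (x, u, w) 0; rewrite F0 !subr0 => h.
apply: le_trans (h _ _) _; rewrite ?ler_wpM2l ?(ltW K0)//.
by rewrite /= !normr0.
Qed.

End Plant.

(** * Picard iteration *)

Section GeometricLimits.
Context {R : realType}.

Lemma le_of_geometric (x y c : R) : (forall j, x <= y + c / 2 ^+ j) -> x <= y.
Proof.
move=> xy; apply/ler_addgt0Pr => e e0.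
have [j] := @near_infty_natSinv_expn_lt R (PosNum (divr_gt0 e0 (ltr_pwDr ltr01 (normr_ge0 c)))).
move=> _ /(_ j (leqnn j)) /= h; rewrite (le_trans (xy j))// lerD2l.
rewrite div1r ltr_pdivlMr in h; last by rewrite ltr_pwDr.
rewrite mulrC; apply: le_trans (ltW h); rewrite ler_wpM2l ?invr_ge0 ?exprn_ge0//.
by rewrite (le_trans (ler_norm _))// lerDl.
Qed.

(** The error bars [u j - 2c/2^j] increase and [u j + 2c/2^j] decrease, so the supremum of the lower
    ones is the limit, with an explicit rate. *)
Lemma geometric_limit (u : nat -> R) (c : R) :
  (forall j, `|u j.+1 - u j| <= c / 2 ^+ j) ->
  exists l, forall j, `|u j - l| <= 2 * c / 2 ^+ j.
Proof.
move=> uc.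
have halves j : c / 2 ^+ j.+1 = (c / 2 ^+ j) / 2 by rewrite exprS invfM mulrCA mulrC.
pose v j := u j - 2 * (c / 2 ^+ j); pose v' j := u j + 2 * (c / 2 ^+ j).
have uc' j : - (c / 2 ^+ j) <= u j.+1 - u j <= c / 2 ^+ j by rewrite -ler_norml.
have c0 j : 0 <= c / 2 ^+ j by rewrite (le_trans _ (uc j)).
have vS j : v j <= v j.+1.
  by rewrite /v halves; have /andP[? ?] := uc' j; lra.
have v'S j : v' j.+1 <= v' j.
  by rewrite /v' halves; have /andP[? ?] := uc' j; lra.
have vh : {homo v : i j / (i <= j)%N >-> i <= j} by exact: homo_leq le_trans vS.
have v'h : {homo v' : i j / (i <= j)%N >-> j <= i}.
  by apply: (@homo_leq _ v' (fun x y => y <= x)) => // y x z /[swap]; exact: le_trans.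
have vv' i j : v i <= v' j.
  apply: (le_trans (vh _ _ (leq_maxl i j))).
  apply: le_trans (v'h _ _ (leq_maxr i j)).
  by rewrite /v /v'; have := c0 (maxn i j); lra.
have ub j : ubound (range v) (v' j) by move=> _ [i _ <-].
exists (sup (range v)) => j.
have sv : v j <= sup (range v) by apply: ub_le_sup; [exists (v' 0%N)|exists j].
have sv' : sup (range v) <= v' j by apply: ge_sup => //; exists (v 0%N); exists 0%N.
rewrite ler_distlC -mulrA; move: sv sv'; rewrite /v /v' => ? ?.
by apply/andP; split; lra.
Qed.

End GeometricLimits.

Section Clamp.
Context {R : realType}.
Implicit Types a b t s : R.

(** Used to extend paths from [[a, b]] to the whole line and, coordinatewise, to retract states onto
    a ball. *)
Definition clamp a b t := Num.max a (Num.min b t).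

Lemma clamp_itv a b t : a <= b -> a <= clamp a b t <= b.
Proof. by move=> ab; rewrite /clamp le_max lexx/= ge_max ab ge_min lexx. Qed.

Lemma clamp_id a b t : a <= t <= b -> clamp a b t = t.
Proof. by move=> /andP[aT tb]; rewrite /clamp (min_r tb) (max_r aT). Qed.

Lemma clamp_lip a b t s : a <= b -> `|clamp a b t - clamp a b s| <= `|t - s|.
Proof.
move=> ab; rewrite ler_distl /clamp.
have := ler_norm (t - s); have := ler_norm (s - t); rewrite distrC => h1 h2.
have [bt|tb] := leP b t; have [bs|sb] := leP b s;
  have [aT|ta] := leP a t; have [aS|sa] := leP a s;
  have [aB|ba] := leP a b; apply/andP; split; lra.
Qed.

Lemma clamp_continuous a b : a <= b -> continuous (clamp a b).
Proof.
move=> ab t; apply/cvgrPdist_lt => e e0; near=> s.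
by rewrite (le_lt_trans (clamp_lip _ _ ab)).
Unshelve. all: by end_near. Qed.

End Clamp.

Section IntegralEquation.
Context {R : realType} {n : nat}.
Variables (a b : R) (ab : a <= b).
Implicit Types (phi psi : R -> 'rV[R]_n) (g : R -> 'rV[R]_n) (x : 'rV[R]_n).

Section Picard.
Variables (G : R -> 'rV[R]_n -> 'rV[R]_n) (C K : R) (x : 'rV[R]_n).
Hypotheses (C0 : 0 <= C) (K0 : 0 <= K) (Kab : K * (b - a) <= 1 / 2).
Hypothesis GC : forall t y, a <= t <= b -> `|G t y| <= C.
Hypothesis GK : forall t y z, a <= t <= b -> `|G t y - G t z| <= K * `|y - z|.
Hypothesis Gint : forall phi, continuous phi ->
  vintegrable `[a, b] (fun t => G t (phi t)).

(** Clamping the upper limit makes [Phi phi] Lipschitz on the whole line, so the iterates stay among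
    the functions to which [Gint] applies. *)
Let Phi phi t := x + vintegral `[a, clamp a b t] (fun s => G s (phi s)).

Let Gint_le phi t : continuous phi -> a <= t <= b ->
  vintegrable `[a, t] (fun s => G s (phi s)).
Proof. by move=> cphi /andP[_ tb]; apply: vintegrableS (Gint cphi). Qed.

Let Phi_lip phi s t : continuous phi -> `|Phi phi s - Phi phi t| <= C * `|s - t|.
Proof.
move=> cphi; wlog st : s t / clamp a b s <= clamp a b t => [hw|].
  have [/hw//|/ltW/hw] := leP (clamp a b s) (clamp a b t).
  by move=> lip_ts; rewrite distrC (distrC s); exact: lip_ts.
have /andP[as_ sb] := clamp_itv s ab; have /andP[at_ tb] := clamp_itv t ab.
apply: (@le_trans _ _ (C * (clamp a b t - clamp a b s))); last first.
  have := clamp_lip s t ab; rewrite distrC ger0_norm ?subr_ge0// => cst_le.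
  exact: ler_wpM2l.
rewrite /Phi (@vintegral_split _ _ a (clamp a b s) (clamp a b t)) ?as_//; last first.
  by apply: Gint_le; rewrite ?at_.
rewrite opprD addrACA subrr add0r opprD addrA subrr add0r normrN.
apply: vintegral_norm_le => //.
  by apply: vintegrableS (Gint cphi).
move=> r /andP[? ?]; apply: GC; apply/andP; split; lra.
Qed.

Let Phi_continuous phi : continuous phi -> continuous (Phi phi).
Proof. by move=> cphi; apply: (@lipschitz_continuous _ _ _ _ C) => s t; exact: Phi_lip. Qed.

Let Phi_contract phi psi (e : R) : continuous phi -> continuous psi -> 0 <= e ->
  (forall t, a <= t <= b -> `|phi t - psi t| <= e) ->
  forall t, `|Phi phi t - Phi psi t| <= e / 2.
Proof.
move=> cphi cpsi e0 pe t; have atb := clamp_itv t ab; have /andP[at_ tb] := atb.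
rewrite /Phi opprD addrACA subrr add0r vintegralB; try exact: Gint_le.
apply: (@le_trans _ _ (K * e * (clamp a b t - a))).
  apply: vintegral_norm_le => //; first by rewrite mulr_ge0.
    by apply: vintegrableB; exact: Gint_le.
  move=> s /andP[? ?]; have asb : a <= s <= b by apply/andP; split; lra.
  by rewrite (le_trans (GK _ _ asb))// ler_wpM2l// pe.
apply: (@le_trans _ _ (K * (b - a) * e)).
  by rewrite mulrAC ler_wpM2r// ler_wpM2l// lerD2r.
rewrite (le_trans (ler_wpM2r e0 Kab))//; lra.
Qed.

(** [Phi] halves sup distances and the first displacement is at most [C * (b - a)], so the iterates
    converge pointwise at a geometric rate. The common Lipschitz constant [C] passes to the limit,
    which is therefore continuous and can be fed to [Phi] again. *)
Lemma picard : exists phi, [/\ continuous phi, phi a = x &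
  forall t, a <= t <= b -> phi t = x + vintegral `[a, t] (fun s => G s (phi s))].
Proof.
pose u j := iter j Phi (fun=> x).
have cu j : continuous (u j).
  by elim: j => [|j IHj]; [move=> t; exact: cvg_cst|exact: Phi_continuous].
pose e0 := C * (b - a).
have e00 : 0 <= e0 by rewrite mulr_ge0// subr_ge0.
have uS j t : `|u j.+1 t - u j t| <= e0 / 2 ^+ j.
  elim: j t => [|j IHj] t.
    rewrite /= /Phi expr0 divr1 addrC addKr.
    have /andP[? ?] := clamp_itv t ab.
    apply: (@le_trans _ _ (C * (clamp a b t - a))); last first.
      by rewrite ler_wpM2l// lerD2r.
    apply: vintegral_norm_le => //; first by apply: Gint_le; [exact: (cu 0%N)|exact: clamp_itv].
    by move=> s /andP[? ?]; apply: GC; apply/andP; split; lra.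
  rewrite exprSr invfM mulrA.
  have ej : 0 <= e0 / 2 ^+ j by rewrite divr_ge0.
  by apply: (Phi_contract (cu j.+1) (cu j) ej) => s _; exact: IHj.
have /choice[phi0 phiP] : forall t, exists y, forall j,
    `|u j t - y| <= 2 * e0 / 2 ^+ j.
  move=> t; have /choice[l lP] : forall i, exists l, forall j,
      `|u j t 0 i - l| <= 2 * e0 / 2 ^+ j.
    move=> i; apply: geometric_limit => j; apply: le_trans (uS j t).
    by have := rV_norm_coord (u j.+1 t - u j t) i; rewrite !mxE.
  exists (\row_i l i) => j; apply: rV_norm_le => [|i]; first by rewrite divr_ge0// mulr_ge0.
  by rewrite !mxE.
have phi_lip s t : `|phi0 s - phi0 t| <= C * `|s - t|.
  apply: (@le_of_geometric _ _ _ (4 * e0 + 4 * e0)) => -[|j].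
    rewrite expr0 divr1.
    rewrite (_ : _ - _ = - (u 0%N s - phi0 s) + (u 0%N t - phi0 t)); last first.
      by rewrite /= opprB addrA subrK.
    rewrite (le_trans (ler_normD _ _))// normrN.
    have := phiP s 0%N; have := phiP t 0%N; rewrite expr0 !divr1.
    have : 0 <= C * `|s - t| by rewrite mulr_ge0.
    lra.
  rewrite (_ : _ - _ =
      (u j.+1 s - u j.+1 t) - (u j.+1 s - phi0 s) + (u j.+1 t - phi0 t)); last first.
    by apply/rowP => i; rewrite !mxE; ring.
  rewrite (le_trans (ler_normD _ _))// (le_trans (lerD (ler_normB _ _) (lexx _)))//.
  rewrite -addrA lerD ?Phi_lip//.
  have := phiP s j.+1; have := phiP t j.+1.
  have : 0 <= e0 / 2 ^+ j.+1 by rewrite divr_ge0.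
  lra.
have cphi := lipschitz_continuous phi_lip.
have fixP t : a <= t <= b -> phi0 t = Phi phi0 t.
  move=> atb; apply/subr0_eq/normr0_eq0/le_anti; rewrite normr_ge0 andbT.
  apply: (@le_of_geometric _ _ _ (2 * e0)) => j.
  rewrite add0r (_ : _ - _ = - (u j.+1 t - phi0 t) + (u j.+1 t - Phi phi0 t)); last first.
    by rewrite opprB addrA subrK.
  rewrite (le_trans (ler_normD _ _))// normrN.
  have h1 := phiP t j.+1.
  have h2 : `|u j.+1 t - Phi phi0 t| <= 2 * e0 / 2 ^+ j / 2.
    by apply: Phi_contract => //; rewrite divr_ge0// mulr_ge0.
  move: h1 h2; rewrite exprSr invfM mulrA; lra.
exists phi0; split=> //.
  rewrite fixP ?lexx// /Phi clamp_id ?lexx// vintegral_set1 ?addr0//.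
  by apply: Gint_le; rewrite ?lexx.
by move=> t atb; rewrite {1}fixP// /Phi clamp_id.
Qed.

End Picard.
End IntegralEquation.

(** * A priori bounds for integral equations *)

Section IntegralEquationBounds.
Context {R : realType} {n : nat}.
Variables (a b : R) (ab : a <= b).
Implicit Types (phi g : R -> 'rV[R]_n) (x : 'rV[R]_n).

Definition integral_solution x g phi :=
  [/\ {within `[a, b], continuous phi}, vintegrable `[a, b] g &
      forall t, a <= t <= b -> phi t = x + vintegral `[a, t] g].

(** The clamp turns continuity within [[a, b]] into continuity on the line, as the extremum and
    intermediate value arguments below require. *)
Lemma integral_solution_clamp x g phi : integral_solution x g phi ->
  continuous (fun t => `|phi (clamp a b t)|).
Proof.
move=> [cphi _ _] t; apply: (@continuous_comp _ _ _ (phi \o clamp a b)).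
  apply: (continuous_within_comp cphi); first exact: clamp_continuous.
  by move=> s; rewrite /= in_itv/= clamp_itv.
exact: norm_continuous.
Qed.

Lemma integral_solution_start x g phi : integral_solution x g phi -> phi a = x.
Proof.
move=> [_ ig ->]; rewrite ?lexx// vintegral_set1 ?addr0//.
by apply: vintegrableS ig.
Qed.

Lemma integral_solution_near x g phi (C t : R) : integral_solution x g phi -> 0 <= C ->
  a <= t <= b -> (forall s, a <= s <= t -> `|g s| <= C) ->
  `|phi t - x| <= C * (t - a).
Proof.
move=> [_ ig h] C0 /andP[at_ tb] gC; rewrite h ?at_// addrC addKr.
by apply: vintegral_norm_le => //; apply: vintegrableS ig.
Qed.

(* At the first time where [phi] has norm [B], the bound on [g] up to that time
   keeps [phi] strictly inside the ball. *)
Lemma integral_solution_bounded x g phi (B C : R) : integral_solution x g phi ->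
  0 <= C -> `|x| + C * (b - a) < B ->
  (forall t, a <= t <= b -> `|phi t| <= B -> `|g t| <= C) ->
  forall t, a <= t <= b -> `|phi t| <= B.
Proof.
move=> sol C0 xB gC t tab; rewrite leNgt; apply/negP => Bt.
have cN := integral_solution_clamp sol.
have phia := integral_solution_start sol.
have xltB : `|x| < B by apply: le_lt_trans xB; rewrite lerDl mulr_ge0// subr_ge0.
pose A := [set s | B <= `|phi (clamp a b s)|] `&` `[a, b]%classic.
have cA : compact A.
  rewrite /A setIC; apply: compact_closedI; first exact: segment_compact.
  by apply: (closed_comp _ (@closed_ge _ B)) => s _; exact: cN.
have A0 : A !=set0.
  by exists t; split; rewrite /= ?in_itv//= clamp_id// ltW.
have [c + cmin] := compact_EVT_min A0 cA (continuous_subspaceT (fun t : R => @cvg_id _ (nbhs t))).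
rewrite inE => -[/= Bc]; rewrite in_itv/= => cab.
rewrite clamp_id// in Bc.
have /andP[ac cb] := cab.
have below s : a <= s <= c -> `|phi s| <= B.
  move=> /andP[as_ sc]; rewrite leNgt; apply/negP => Bs.
  have sab : a <= s <= b by apply/andP; split; lra.
  have [|r] := @IVT _ (fun r => `|phi (clamp a b r)|) a s B as_ (continuous_subspaceT cN).
    by rewrite clamp_id ?lexx// clamp_id// phia ge_min le_max (ltW xltB) (ltW Bs) orbT.
  rewrite in_itv/= => /andP[ar rs] phir.
  have rab : a <= r <= b by apply/andP; split; lra.
  have : c <= r by apply: cmin; rewrite inE; split; rewrite /= ?in_itv//= phir.
  move=> cr; have rc : r = s by apply/le_anti; rewrite rs/=; lra.
  by move: phir Bs; rewrite rc clamp_id// => ->; rewrite ltxx.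
have near_ : `|phi c - x| <= C * (c - a).
  apply: (integral_solution_near sol) => // s asc.
  by apply: gC; [move: asc => /andP[? ?]; apply/andP; split; lra|exact: below].
have : `|phi c| <= `|phi c - x| + `|x| by rewrite -{1}(subrK x (phi c)) ler_normD.
have : C * (c - a) <= C * (b - a) by rewrite ler_wpM2l// lerD2r.
lra.
Qed.

(** In place of Gronwall's inequality: the maximal distance [D] satisfies
    [D <= (K * D + e) * (b - a)], and [K * (b - a) <= 1 / 2] absorbs the term in [D]. The difference
    of the two paths is itself an [integral_solution], which is possible because the integrand is a
    separate parameter of that notion. *)
Lemma integral_solution_compare x g1 g2 phi1 phi2 (K e : R) :
  integral_solution x g1 phi1 -> integral_solution x g2 phi2 ->
  0 <= K -> K * (b - a) <= 1 / 2 -> 0 <= e ->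
  (forall t, a <= t <= b -> `|g1 t - g2 t| <= K * `|phi1 t - phi2 t| + e) ->
  forall t, a <= t <= b -> `|phi1 t - phi2 t| <= 2 * e * (b - a).
Proof.
move=> sol1 sol2 K0 Kab e0 g12.
have [c1 i1 h1] := sol1; have [c2 i2 h2] := sol2.
have sol : integral_solution 0 (fun t => g1 t - g2 t) (fun t => phi1 t - phi2 t).
  split; last 2 first.
  - exact: vintegrableB.
  - move=> t tab; have /andP[at_ tb] := tab.
    rewrite h1// h2// add0r -vintegralB; last 2 first.
    + by apply: vintegrableS i1.
    + by apply: vintegrableS i2.
    by rewrite opprD addrACA subrr add0r.
  - by move=> t; apply: continuousB; [exact: c1|exact: c2].
have [c] := EVT_max ab (continuous_subspaceT (integral_solution_clamp sol)).
rewrite in_itv/= => cab cmax.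
have phi_le t : a <= t <= b -> `|phi1 t - phi2 t| <= `|phi1 c - phi2 c|.
  by move=> tab; have := cmax t; rewrite in_itv/= !clamp_id// tab; exact.
have /andP[ac cb] := cab.
set D := `|phi1 c - phi2 c| in phi_le.
have D0 : 0 <= D by exact: normr_ge0.
have Dle : D <= (K * D + e) * (c - a).
  have := @integral_solution_near _ _ _ (K * D + e) c sol.
  rewrite subr0; apply => //; first by rewrite addr_ge0// mulr_ge0.
  move=> s /andP[as_ sc]; have sab : a <= s <= b by apply/andP; split; lra.
  by rewrite (le_trans (g12 _ sab))// lerD2r ler_wpM2l// phi_le.
have Dle' : D <= (K * D + e) * (b - a).
  by rewrite (le_trans Dle)// ler_wpM2l ?lerD2r// addr_ge0// mulr_ge0.
move=> t tab; rewrite (le_trans (phi_le _ tab))//.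
have := ler_wpM2r D0 Kab; nra.
Qed.

End IntegralEquationBounds.

(** * The exact plant model *)

Section Clip.
Context {R : realType} {n : nat}.
Implicit Types (B : R) (x y : 'rV[R]_n).

(** A 1-Lipschitz retraction onto the sup-norm ball. Composed with the state argument of [f], it
    makes the field bounded and globally Lipschitz in the state, as [picard] requires. *)
Definition clip B x : 'rV[R]_n := \row_i clamp (- B) B (x 0 i).

Lemma clip_le B x : 0 <= B -> `|clip B x| <= B.
Proof.
move=> B0; apply: rV_norm_le => // i; rewrite mxE ler_norml clamp_itv//; lra.
Qed.

Lemma clip_id B x : `|x| <= B -> clip B x = x.
Proof.
move=> xB; apply/rowP => i; rewrite mxE clamp_id// -ler_norml.
exact: le_trans (rV_norm_coord _ _) xB.
Qed.

Lemma clip_lip B x y : 0 <= B -> `|clip B x - clip B y| <= `|x - y|.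
Proof.
move=> B0; apply: rV_norm_le => // i; rewrite !mxE.
rewrite (le_trans (clamp_lip _ _ _))//; first lra.
by have := rV_norm_coord (x - y) i; rewrite !mxE.
Qed.

Lemma clip_continuous B : 0 <= B -> continuous (clip B).
Proof.
move=> B0; apply: continuous_rV => i.
rewrite (_ : (fun t => _) = clamp (- B) B \o (fun x : 'rV[R]_n => x 0 i)); last first.
  by apply/funext => x; rewrite mxE.
move=> x; apply: continuous_comp; first exact: coord_continuous.
by apply: clamp_continuous; lra.
Qed.

End Clip.

Section ExactModel.
Context {R : realType} {n m p : nat}.
Variable f : 'rV[R]_n -> 'rV[R]_m -> 'rV[R]_p -> 'rV[R]_n.
Hypothesis f_lip : locally_lipschitz_field f.
Variables (B K : R) (B0 : 0 < B) (K0 : 0 < K).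
Hypothesis f_K : forall x1 x2 u1 u2 w, `|x1| <= B -> `|x2| <= B ->
  `|u1| <= B -> `|u2| <= B -> `|w| <= B ->
  `|f x1 u1 w - f x2 u2 w| <= K * (`|x1 - x2| + `|u1 - u2|).
Hypothesis f_B : forall x u w, `|x| <= B -> `|u| <= B -> `|w| <= B ->
  `|f x u w| <= K * B.
Variables (T : R) (T0 : 0 < T) (KT : K * T <= 1 / 4).
Variables (w : R -> 'rV[R]_p) (mw : measurable_signal w).
Hypothesis wB : forall t, 0 <= t -> `|w t| <= B.
Variable k : nat.
Implicit Types (x y : 'rV[R]_n) (u : 'rV[R]_m).

Let a := k%:R * T.
Let b := k.+1%:R * T.

Let a0 : 0 <= a. Proof. by rewrite mulr_ge0// ltW. Qed.
Let ba : b - a = T. Proof. by rewrite -mulrBl -natrB// subSnn mul1r. Qed.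
Let ab : a <= b. Proof. by rewrite -subr_ge0 ba ltW. Qed.
Let wB' t : a <= t <= b -> `|w t| <= B.
Proof. by move=> /andP[at_ _]; apply: wB; exact: le_trans at_. Qed.

Lemma field_along_measurable u (phi : R -> 'rV[R]_n) i : continuous phi ->
  @measurable_fun _ _ (lebesgueR R) R `[a, b] (fun t => f (clip B (phi t)) u (w t) 0 i).
Proof.
(* State and disturbance are joined into one row vector, so that the field becomes a continuous
   function of a single vector. *)
move=> cphi; pose F (z : 'rV[R]_(n + p)) := f (clip B (lsubmx z)) u (rsubmx z) 0 i.
have cF : continuous F.
  move=> z; apply: (@continuous_comp _ _ _ (fun z : 'rV[R]_(n + p) =>
      f (clip B (lsubmx z)) u (rsubmx z)) (fun v : 'rV[R]_n => v 0 i)); last first.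
    exact: coord_continuous.
  pose G (y : 'rV[R]_n * 'rV[R]_m * 'rV[R]_p) := f y.1.1 y.1.2 y.2.
  apply: (@continuous_comp _ _ _ (fun z : 'rV[R]_(n + p) =>
      (clip B (lsubmx z), u, rsubmx z)) G); last first.
    exact: (locally_lipschitz_continuous (F := G) f_lip).
  have cl : continuous (fun z : 'rV[R]_(n + p) => lsubmx z).
    apply: continuous_rV => j.
    rewrite (_ : (fun _ => _) = fun z : 'rV[R]_(n + p) => z 0 (lshift p j)).
      exact: coord_continuous.
    by apply/funext => z'; rewrite mxE.
  have cr : continuous (fun z : 'rV[R]_(n + p) => rsubmx z).
    apply: continuous_rV => j.
    rewrite (_ : (fun _ => _) = fun z : 'rV[R]_(n + p) => z 0 (rshift n j)).
      exact: coord_continuous.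
    by apply/funext => z'; rewrite mxE.
  have h1 : clip B (lsubmx z') @[z' --> z] --> clip B (lsubmx z).
    by apply: continuous_comp; [exact: cl|apply: clip_continuous; exact: ltW].
  exact: cvg_pair (cvg_pair h1 (cvg_cst u)) (cr z).
pose v t : 'rV[R]_(n + p) := row_mx (phi t) (w t).
have := @measurable_fun_continuous_rV _ (lebesgueR R) R (n + p) `[a, b] v F.
rewrite /F /v (_ : _ \o _ = fun t => f (clip B (phi t)) u (w t) 0 i); last first.
  by apply/funext => t /=; rewrite row_mxKl row_mxKr.
apply => [j|]; last exact: cF.
rewrite -(splitK j); case: (fintype.split j) => j' /=.
  rewrite (_ : (fun t => _) = fun t => phi t 0 j'); last first.
    by apply/funext => t; rewrite row_mxEl.
  move=> mab Y mY; apply: measurable_lebesgueR.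
  apply: measurableI; first exact: measurable_itv.
  rewrite -[X in measurable X]setTI; apply: continuous_measurable_fun => // t.
  apply: (@continuous_comp _ _ _ phi (fun v : 'rV[R]_n => v 0 j')); first exact: cphi.
  exact: coord_continuous.
rewrite (_ : (fun t => _) = fun t => w t 0 j'); last first.
  by apply/funext => t; rewrite row_mxEr.
apply: measurable_funS (mw j'); first exact: measurable_itv_lebesgueR.
by move=> t; rewrite /= !in_itv/= => /andP[at_ _]; rewrite andbT; exact: le_trans at_.
Qed.

(** The clipped equation is solved first. Its speed is at most [K * B], and [B / 2 + K * B * T] is
    below [B], so the solution never leaves the ball and clipping never acts. *)
Lemma exact_model_exists x u : `|x| <= B / 2 -> `|u| <= B ->
  exists y, exact_model f T x u w k y.
Proof.
move=> xB uB.
have C0 : 0 <= K * B by rewrite mulr_ge0 ?ltW.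
have Kab : K * (b - a) <= 1 / 2 by rewrite ba (le_trans KT)//; lra.
pose G t y := f (clip B y) u (w t).
have GC t y : a <= t <= b -> `|G t y| <= K * B.
  by move=> tab; apply: f_B => //; [apply: clip_le; exact: ltW|exact: wB'].
have GK t y z : a <= t <= b -> `|G t y - G t z| <= K * `|y - z|.
  move=> tab; have B0' := ltW B0.
  rewrite (le_trans (f_K _ _ _ _ _))// ?clip_le ?wB'//.
  by rewrite subrr normr0 addr0 ler_wpM2l ?(ltW K0)// clip_lip.
have Gint phi : continuous phi -> vintegrable `[a, b] (fun t => G t (phi t)).
  move=> cphi i; apply: (@bounded_integrable _ _ _ _ _ _ (K * B)).
  - exact: measurable_itv_lebesgueR.
  - exact: completed_measure_itvcc_lty.
  - exact: field_along_measurable.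
  - move=> t; rewrite /= in_itv/= => tab.
    exact: le_trans (rV_norm_coord _ _) (GC _ _ tab).
have [phi [cphi phia phiP]] := picard ab x C0 (ltW K0) Kab GC GK Gint.
have sol : integral_solution a b x (fun t => G t (phi t)) phi.
  by split => //; [exact: continuous_subspaceT|exact: Gint].
have phiB t : a <= t <= b -> `|phi t| <= B.
  apply: (integral_solution_bounded ab sol C0); last by move=> s sab _; exact: GC.
  rewrite ba mulrAC (le_lt_trans (lerD xB (ler_wpM2r (ltW B0) KT)))//; have := B0; lra.
have GE t : a <= t <= b -> G t (phi t) = f (phi t) u (w t).
  by move=> tab; rewrite /G clip_id ?phiB.
have intE s : a <= s <= b ->
    vintegral `[a, s] (fun t => G t (phi t)) = vintegral `[a, s] (fun t => f (phi t) u (w t)).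
  move=> /andP[? ?]; apply/rowP => i; rewrite !mxE; apply: eq_Rintegral => t.
  by rewrite inE/= in_itv/= => /andP[? ?]; rewrite GE//; apply/andP; split; lra.
exists (x + vintegral (period T k) (fun t => f (phi t) u (w t))), phi; split => //.
split; first exact: continuous_subspaceT.
  move=> i; have := Gint phi cphi i; apply: eq_integrable => [|t].
    exact: measurable_itv_lebesgueR.
  by rewrite inE/= in_itv/= => tab; rewrite GE.
by move=> t; rewrite in_itv/= => tab; rewrite phia phiP// intE.
Qed.

(** The confinement to the ball holds for every solution, not only for the constructed one; the
    estimates below thus apply to any value related by [exact_model]. *)
Lemma exact_model_solution x u y : `|x| <= B / 2 -> `|u| <= B ->
  exact_model f T x u w k y -> exists phi,
  [/\ integral_solution a b x (fun t => f (phi t) u (w t)) phi,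
      forall t, a <= t <= b -> `|phi t| <= B & phi b = y].
Proof.
move=> xB uB [phi [[cphi ig phiP] phia ->]]; exists phi.
have sol : integral_solution a b x (fun t => f (phi t) u (w t)) phi.
  by split => // t tab; rewrite phiP ?in_itv// phia.
split => //; last by rewrite phiP ?phia// in_itv/= lexx ab.
have C0 : 0 <= K * B by rewrite mulr_ge0 ?ltW.
apply: (integral_solution_bounded ab sol C0).
  rewrite ba mulrAC (le_lt_trans (lerD xB (ler_wpM2r (ltW B0) KT)))//; have := B0; lra.
by move=> t tab phiB; apply: f_B => //; exact: wB'.
Qed.

Lemma exact_model_near x u y : `|x| <= B / 2 -> `|u| <= B ->
  exact_model f T x u w k y -> `|y - x| <= K * B * T.
Proof.
move=> xB uB /(exact_model_solution xB uB)[phi [sol phiB <-]].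
rewrite -ba; apply: (integral_solution_near sol); rewrite ?lexx ?ab//.
  by rewrite mulr_ge0 ?ltW.
by move=> t tab; apply: f_B => //; [exact: phiB|exact: wB'].
Qed.

(** Both solutions start at the same point, so the input gap acts only as a forcing term over a time
    [T]. This factor [T] makes the effect of the controller's O(T) drift second order in [T]. *)
Lemma exact_model_input x u1 u2 y1 y2 : `|x| <= B / 2 -> `|u1| <= B -> `|u2| <= B ->
  exact_model f T x u1 w k y1 -> exact_model f T x u2 w k y2 ->
  `|y1 - y2| <= 2 * (K * `|u1 - u2|) * T.
Proof.
move=> xB u1B u2B /(exact_model_solution xB u1B)[phi1 [sol1 phi1B <-]].
move=> /(exact_model_solution xB u2B)[phi2 [sol2 phi2B <-]].
rewrite -ba; apply: (integral_solution_compare ab sol1 sol2 (ltW K0)).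
- by rewrite ba (le_trans KT)//; lra.
- by rewrite mulr_ge0// ltW.
- by move=> t tab; rewrite -mulrDr; apply: f_K; rewrite ?phi1B ?phi2B ?wB'.
- by rewrite lexx ab.
Qed.

End ExactModel.

(** * Decay rates and KL bounds *)

Section InfimumFamilies.
Context {R : realType}.
Variables (S : set R) (h : R -> R -> R).
Hypotheses (S0 : S !=set0) (h_ge0 : forall c s, S s -> 0 <= h c s).

Definition inf_family c := inf [set h c s | s in S].

Lemma inf_family_le c s : S s -> inf_family c <= h c s.
Proof. by move=> Ss; apply: ge_inf; [exists 0 => _ [t St <-]; exact: h_ge0|exists s]. Qed.

Lemma le_inf_family c z : (forall s, S s -> z <= h c s) -> z <= inf_family c.
Proof.
move=> zh; apply: lb_le_inf => [|_ [s Ss <-]]; last exact: zh.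
by have [s Ss] := S0; exists (h c s), s.
Qed.

Lemma inf_family_lip (L : R) :
  (forall c c' s, S s -> h c s <= h c' s + L * `|c - c'|) -> continuous inf_family.
Proof.
move=> hL; have half c c' : inf_family c <= inf_family c' + L * `|c - c'|.
  rewrite -lerBlDr; apply: le_inf_family => s Ss; rewrite lerBlDr.
  exact: le_trans (inf_family_le _ Ss) (hL _ _ _ Ss).
apply: (@lipschitz_continuous _ _ _ inf_family L) => c c'.
rewrite ler_norml; have := half c c'; have := half c' c; rewrite (distrC c' c) => ? ?.
by apply/andP; split; lra.
Qed.

End InfimumFamilies.

Section DecayRate.
Context {R : realType}.
Variables al au a : R -> R.
Hypotheses (alK : classKoo al) (auK : classKoo au) (aPD : classPD a).

Let a_ge0 s : 0 <= s -> 0 <= a s. Proof. exact: classPD_ge0. Qed.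

Let excess (x : R) := Num.max 0 x.

Let excess_ge0 x : 0 <= excess x. Proof. by rewrite /excess le_max lexx. Qed.

Let excess_mono x y : x <= y -> excess x <= excess y.
Proof. by move=> xy; rewrite /excess le_max2. Qed.

Let excess_lip x y : excess x <= excess y + `|x - y|.
Proof.
have := ler_norm (x - y); have := normr_ge0 (x - y).
by rewrite /excess; have [?|?] := leP 0 x; have [?|?] := leP 0 y; lra.
Qed.

Let excess_continuous : continuous excess.
Proof.
apply: (@lipschitz_continuous _ _ _ excess 1) => x y; rewrite mul1r ler_norml.
have := excess_lip x y; have := excess_lip y x; rewrite (distrC y) => ? ?.
by apply/andP; split; lra.
Qed.

(** The sign [k] covers both penalties, [c - au s] and [al s - 2 * r]. *)
Let rate_cont (b : R -> R) (c k : R) : classPD b ->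
  continuous (fun s : R => a `|s| + excess (k * (c - b `|s|))).
Proof.
move=> bPD s; apply: cvgD; first exact: (@classPD_continuous R a aPD s).
apply: (@continuous_comp _ _ _ (fun s : R => k * (c - b `|s|)) excess);
  last exact: excess_continuous.
apply: cvgM; first exact: cvg_cst.
apply: cvgB; [exact: cvg_cst|exact: (@classPD_continuous R b bPD s)].
Qed.

(* Penalizing the constraint instead of imposing it makes these infima Lipschitz
   in the parameter; they stay below [a s] wherever the penalty vanishes. *)
Definition near_rate c := inf_family `[0, 1] (fun c s => a s + excess (c - au s)) c.
Definition far_rate r := inf_family `[1, +oo[ (fun r s => a s + excess (al s - 2 * r)) r.

Let near0 : (`[0, 1]%classic : set R) !=set0.
Proof. by exists 0; rewrite /= in_itv/= lexx ler01. Qed.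
Let far0 : (`[1, +oo[%classic : set R) !=set0.
Proof. by exists 1; rewrite /= in_itv/= lexx. Qed.
Let near_ge0 c s : `[0, 1]%classic s -> 0 <= a s + excess (c - au s).
Proof. by rewrite /= in_itv/= => /andP[s0 _]; rewrite addr_ge0// a_ge0. Qed.
Let far_ge0 r s : `[1, +oo[%classic s -> 0 <= a s + excess (al s - 2 * r).
Proof.
by rewrite /= in_itv/= andbT => s1; rewrite addr_ge0// a_ge0// (le_trans ler01).
Qed.

Lemma near_rate_continuous : continuous near_rate.
Proof.
apply: (inf_family_lip near0 near_ge0 (L := 1)) => c c' s _.
rewrite mul1r -addrA lerD2l; apply: le_trans (excess_lip _ (c' - au s)) _.
by rewrite lerD2l opprB addrA subrK.
Qed.

Lemma far_rate_continuous : continuous far_rate.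
Proof.
apply: (inf_family_lip far0 far_ge0 (L := 2)) => r r' s _.
rewrite -addrA lerD2l; apply: le_trans (excess_lip _ (al s - 2 * r')) _.
rewrite lerD2l (_ : _ - _ = 2 * (r' - r)); last by lra.
by rewrite normrM distrC ger0_norm.
Qed.

Lemma near_rate_mono c c' : c <= c' -> near_rate c <= near_rate c'.
Proof.
move=> cc'; apply: (le_inf_family near0) => s Ss.
apply: le_trans (inf_family_le near_ge0 _ Ss) _; rewrite lerD2l excess_mono//; lra.
Qed.

Lemma far_rate_mono r r' : r <= r' -> far_rate r' <= far_rate r.
Proof.
move=> rr'; apply: (le_inf_family far0) => s Ss.
apply: le_trans (inf_family_le far_ge0 _ Ss) _; rewrite lerD2l excess_mono//; lra.
Qed.

Lemma near_rate_ge0 c : 0 <= near_rate c.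
Proof. by apply: (le_inf_family near0) => s Ss; exact: near_ge0. Qed.

(** The infimum is attained by compactness. At [s = 0] the penalty equals [c > 0], since [au 0 = 0];
    elsewhere [a s > 0]. *)
Lemma near_rate_gt0 c : 0 < c -> 0 < near_rate c.
Proof.
move=> c0; have [_ au0 _] := auK.1.1.
have [s] := EVT_min ler01 (continuous_subspaceT (@rate_cont au c 1 auK.1.1)).
rewrite in_itv/= => /andP[s0 s1] smin.
apply: (@lt_le_trans _ _ (a `|s| + excess (1 * (c - au `|s|)))).
  rewrite mul1r ger0_norm//; move: s0; rewrite le_eqVlt => /predU1P[<-|s0].
    by rewrite au0 subr0 ltr_wpDl ?a_ge0// /excess lt_max c0 orbT.
  by rewrite ltr_wpDr//; have [_ _] := aPD; apply.
apply: (le_inf_family near0) => t; rewrite /= in_itv/= => t01.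
have := smin t; rewrite in_itv/= mul1r t01 => /(_ isT).
by rewrite (@ger0_norm _ t) ?mul1r//; case/andP: t01.
Qed.

(** On [[1, X + 1]] the minimum is attained and positive; beyond it [al] is at least [2 * r + 1], so
    the penalty alone is at least 1. *)
Lemma far_rate_gt0 r : 0 < far_rate r.
Proof.
have [X X0 XY] := classKoo_large (2 * r + 1) alK.
have X1 : 1 <= X + 1 by rewrite lerDr ltW.
have [s] := EVT_min X1 (continuous_subspaceT (@rate_cont al (2 * r) (-1) alK.1.1)).
rewrite in_itv/= => /andP[s1 s2] smin.
pose v := a `|s| + excess (-1 * (2 * r - al `|s|)).
apply: (@lt_le_trans _ _ (Num.min 1 v)).
  rewrite lt_min ltr01/= /v ltr_wpDr//; have [_ _] := aPD; apply.
  by rewrite normr_gt0 gt_eqF// (lt_le_trans ltr01).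
apply: (le_inf_family far0) => t; rewrite /= in_itv/= andbT => t1.
have t0 : 0 <= t by exact: le_trans t1.
rewrite ge_min; have [tX|tX] := leP t (X + 1).
  have := smin t; rewrite in_itv/= t1 tX => /(_ isT).
  by rewrite /v (@ger0_norm _ t)// !mulN1r !opprB => ->; rewrite orbT.
have := XY t; have := a_ge0 t0 => at0 /(_ _) h.
have : 2 * r + 1 <= al t by apply: h; lra.
rewrite /excess => ?; apply/orP; left; have [?|?] := leP 0 (al t - 2 * r); lra.
Qed.

Lemma near_rate_le c s : 0 <= s <= 1 -> c <= au s -> near_rate c <= a s.
Proof.
move=> s01 cs; apply: le_trans (inf_family_le near_ge0 _ (_ : _ s)) _.
  by rewrite /= in_itv.
by rewrite /excess max_l ?addr0//; lra.
Qed.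

Lemma far_rate_le r s : 1 <= s -> al s <= 2 * r -> far_rate r <= a s.
Proof.
move=> s1 sr; apply: le_trans (inf_family_le far_ge0 _ (_ : _ s)) _.
  by rewrite /= in_itv/= andbT.
by rewrite /excess max_l ?addr0//; lra.
Qed.

(** The near rate bounds [a s] from below for [s <= 1], the far rate for [s >= 1]. Capping both at 1
    makes their product at most either factor, so one formula covers both ranges. *)
Lemma decay_rate : exists nu1 nu2 : R -> R,
  [/\ [/\ continuous nu1, {homo nu1 : c c' / c <= c'}, forall c, 0 <= nu1 c <= 1 &
          forall c, 0 < c -> 0 < nu1 c],
      [/\ continuous nu2, {homo nu2 : r r' /~ r <= r'} & forall r, 0 < nu2 r <= 1] &
      forall s c r, 0 <= s -> c <= au s -> al s <= 2 * r -> nu1 c * nu2 r <= a s].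
Proof.
exists (fun c => Num.min 1 (near_rate c)), (fun r => Num.min 1 (far_rate r)).
split; first split.
- move=> c; apply: continuous_min; first exact: cst_continuous.
  exact: near_rate_continuous.
- by move=> c c' cc'; rewrite le_min2// near_rate_mono.
- by move=> c; rewrite le_min ler01 near_rate_ge0/= ge_min lexx.
- by move=> c c0; rewrite lt_min ltr01 near_rate_gt0.
- split.
  + move=> c; apply: continuous_min; first exact: cst_continuous.
    exact: far_rate_continuous.
  + by move=> r r' rr'; rewrite le_min2// far_rate_mono.
  + by move=> r; rewrite lt_min ltr01 far_rate_gt0/= ge_min lexx.
- move=> s c r s0 cs sr.
  have m1 : 0 <= Num.min 1 (near_rate c) <= 1.
    by rewrite le_min ler01 near_rate_ge0/= ge_min lexx.
  have m2 : 0 <= Num.min 1 (far_rate r) <= 1.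
    by rewrite le_min ler01 (ltW (far_rate_gt0 r))/= ge_min lexx.
  have [s1|/ltW s1] := leP s 1.
    apply: (@le_trans _ _ (Num.min 1 (near_rate c))); first nra.
    by rewrite ge_min near_rate_le ?s0 ?orbT.
  apply: (@le_trans _ _ (Num.min 1 (far_rate r))); first nra.
  by rewrite ge_min far_rate_le ?orbT.
Qed.

End DecayRate.

Section PracticalDecay.
Context {R : realType}.
Variables (z S : nat -> R) (e : R) (N : nat).
Hypothesis e0 : 0 < e.

Variables (nu1 nu2 : R -> R) (T : R).
Hypotheses (nu1_mono : {homo nu1 : c c' / c <= c'}) (nu1_01 : forall c, 0 <= nu1 c <= 1).
Hypothesis nu2_01 : forall r, 0 < nu2 r <= 1.
Hypotheses (T0 : 0 < T) (z00 : 0 <= z 0%N) (S0 : forall j, 0 <= S j).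
Hypothesis S_mono : {homo S : i j / (i <= j)%N >-> i <= j}.
Hypothesis zS_ge0 : forall j, (j <= N)%N -> 0 <= z j + S j.
Hypothesis z_small : forall j, (j < N)%N -> z j.+1 <= z j + e.
Hypothesis z_decay : forall j c r, (j < N)%N -> e <= z j -> c <= z j + S j ->
  z j + S j <= 2 * r -> z j.+1 <= z j - T * (nu1 c * nu2 r) / 2.

Let rho c := c * nu1 c.

Let rho_le c : 0 <= c -> rho c <= c.
Proof. by move=> c0; rewrite ler_piMr//; case/andP: (nu1_01 c). Qed.

Let rho_mono c c' : 0 <= c -> c <= c' -> rho c <= rho c'.
Proof.
move=> c0 cc'; have := nu1_mono cc'; have := nu1_01 c => /andP[? ?] ?.
by apply: ler_pM.
Qed.

(* If [z k] is neither small nor below [S k], then [z] has been decreasing up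
   to time [k] and [S] has stayed below it, so the rate along the way is at
   least [nu1 (z k) * nu2 (z 0)]. *)
Lemma practical_decay k : (k <= N)%N ->
  rho ((z k + S k) / 2) <=
    (2 * z 0%N ^+ 2 + z 0%N) / (1 + k%:R * T * nu2 (z 0%N)) + S k + 2 * e.
Proof.
move=> kN; set q := (_ / (1 + _ * _ * _)).
have nu20 : 0 < nu2 (z 0%N) by case/andP: (nu2_01 (z 0%N)).
have den : 0 < 1 + k%:R * T * nu2 (z 0%N).
  by rewrite ltr_pwDl// !mulr_ge0// ltW.
have q0 : 0 <= q.
  by apply: divr_ge0; [rewrite addr_ge0 ?mulr_ge0 ?exprn_ge0|exact: ltW].
have Sk := S0 k; have zSk := zS_ge0 kN.
have zSk2 : 0 <= (z k + S k) / 2 by move: e0; lra.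
have [zk2|zk2] := ltP (z k) (2 * e); first by have := rho_le zSk2; move: e0; lra.
have [zkS|Skz] := leP (z k) (S k); first by have := rho_le zSk2; move: e0; lra.
suff : rho (z k) <= q.
  have : rho ((z k + S k) / 2) <= rho (z k) by apply: rho_mono => //; move: e0; lra.
  move: e0; lra.
(* Backward induction: a step raises [z] by at most [e], so [z >= 2 * e] forces [z >= e] one step
   earlier, where [z_decay] applies. Taking both of its parameters equal to the current value shows
   that the step did not increase [z]. *)
have zmin i : (i <= k)%N -> z k <= z (k - i)%N.
  elim: i => [|i IHi] ik; first by rewrite subn0.
  have kE : (k - i = (k - i.+1).+1)%N by rewrite subnSK.
  have jN : (k - i.+1 < N)%N by rewrite -kE (leq_trans _ kN)// leq_subr.
  have := IHi (ltnW ik); rewrite kE => zj.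
  have zs := z_small jN.
  have ez : e <= z (k - i.+1)%N by move: e0; lra.
  set y := z (k - i.+1)%N + S (k - i.+1)%N.
  have y0 : 0 <= y by exact: zS_ge0 (ltnW jN).
  have y2 : y <= 2 * y by lra.
  have := z_decay jN ez (lexx y) y2.
  have : 0 <= T * (nu1 y * nu2 y).
    have /andP[? _] := nu1_01 y; have /andP[/ltW ? _] := nu2_01 y.
    by apply: mulr_ge0 (ltW T0) _; exact: mulr_ge0.
  lra.
have zmin' j : (j <= k)%N -> z k <= z j.
  by move=> jk; have := zmin (k - j)%N (leq_subr _ _); rewrite subKn.
set d := nu1 (z k) * nu2 (z 0%N).
have d0 : 0 <= d by rewrite mulr_ge0 ?(ltW nu20)//; case/andP: (nu1_01 (z k)).
have Td0 : 0 <= T * d / 2 by rewrite divr_ge0// mulr_ge0// ltW.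
(* Here the parameters are [z k] and [z 0] at every step: [S j <= S k < z k <= z j <= z 0] gives
   [z j + S j <= 2 * z 0]. *)
have zdec j : (j <= k)%N -> z j <= z 0%N - j%:R * (T * d / 2).
  elim: j => [|j IHj] jk; first by rewrite mul0r subr0.
  have zj := IHj (ltnW jk); have zkj := zmin' j (ltnW jk).
  have Sj : S j <= S k by apply: S_mono; exact: ltnW.
  have Sj0 := S0 j.
  have zj0 : z j <= z 0%N.
    by rewrite (le_trans zj)// gerBl mulr_ge0.
  have ej : e <= z j by move: e0; lra.
  have zkS : z k <= z j + S j by lra.
  have zj2 : z j + S j <= 2 * z 0%N by lra.
  have := z_decay (leq_trans jk kN) ej zkS zj2; rewrite -/d -(natr1 j); lra.
have := zdec k (leqnn k); set kd := k%:R * _ => zkd.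
rewrite /q ler_pdivlMr// /rho.
(* Both [z k] and [kd] are at most [z 0]; the two summands thus give [z 0] and [2 * z 0 ^+ 2], the
   numerator of the bound. *)
have -> : z k * nu1 (z k) * (1 + k%:R * T * nu2 (z 0%N)) =
    z k * nu1 (z k) + z k * (2 * kd).
  by rewrite /kd /d; field.
have zk0 : 0 <= z k by move: e0; lra.
have := rho_le zk0; rewrite /rho => rz.
have kd0 : 0 <= kd by rewrite /kd mulr_ge0.
rewrite expr2; move: e0; nra.
Qed.

End PracticalDecay.

Section OutputGains.
Context {R : realType}.

(** A positive nondecreasing factor preserves strict growth, and it is at least [nu 1] once
    [al s / 2 >= 1], which gives divergence. *)
Lemma classKoo_mul_rate (al nu : R -> R) : classKoo al -> continuous nu ->
  {homo nu : c c' / c <= c'} -> (forall c, 0 < c -> 0 < nu c) ->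
  classKoo (fun s => al s / 2 * nu (al s / 2)).
Proof.
move=> alK cnu nu_mono nu0; have [[alPD al_mono] al_oo] := alK.
have [cal al0 al_gt0] := alPD.
have mono (c c' : R) : 0 <= c -> c < c' -> c * nu c < c' * nu c'.
  move=> c0 cc'; have c'0 : 0 < nu c' by apply: nu0; lra.
  apply: (@le_lt_trans _ _ (c * nu c')); last by rewrite ltr_pM2r.
  by rewrite ler_wpM2l// nu_mono// ltW.
split; [split; [split|]|].
- have chalf : continuous (fun c : R => c / 2 * nu (c / 2)).
    move=> c; have ch : (fun x : R => x / 2) x @[x --> c] --> c / 2.
      by apply: cvgM; [exact: cvg_id|exact: cvg_cst].
    apply: cvgM; first exact: ch.
    by apply: (@continuous_comp _ _ _ (fun x : R => x / 2) nu); [exact: ch|exact: cnu].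
  by move=> x; apply: continuous_comp (cal x) (chalf (al x)).
- by rewrite al0 mul0r mul0r.
- by move=> s s0; have := al_gt0 s s0 => as0; rewrite mulr_gt0 ?nu0 ?divr_gt0.
- move=> s t s0 t0 st; have := al_mono s t s0 t0 st => ast.
  apply: mono; last by lra.
  by rewrite divr_ge0// (classPD_ge0 alPD)//; move: s0; rewrite in_itv/= andbT.
- apply/cvgryPge => A.
  have nu1 := nu0 1 ltr01.
  have [X X0 XY] := classKoo_large (2 * (`|A| / nu 1 + 1)) alK.
  exists X; split=> [|s Xs]; first exact: num_real.
  have := XY s (ltW Xs) => h.
  have An : 0 <= `|A| / nu 1 by rewrite divr_ge0// ltW.
  have s1 : 1 <= al s / 2 by lra.
  have := nu_mono _ _ s1 => h1.
  apply: (@le_trans _ _ (`|A| / nu 1 * nu 1)).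
    by rewrite divfK ?gt_eqF// ler_norm.
  apply: ler_pM => //; [exact: ltW|lra].
Qed.

(** The fraction of [practical_decay], with [z 0] replaced by its upper bound [au r] and [k T] by
    [t]. *)
Definition decay_bound (au nu : R -> R) (r t : R) :=
  (2 * au r ^+ 2 + au r) / (1 + t * nu (au r)).

Lemma decay_bound_classKL (au nu : R -> R) : classKoo au -> continuous nu ->
  {homo nu : r r' /~ r <= r'} -> (forall r, 0 < nu r <= 1) ->
  classKL (decay_bound au nu).
Proof.
move=> auK cnu nu_mono nu01; have [[auPD au_mono] _] := auK.
have [cau au0 au_gt0] := auPD.
have nu_gt0 r : 0 < nu r by case/andP: (nu01 r).
have den t r : 0 <= t -> 0 < 1 + t * nu r.
  by move=> t0; rewrite ltr_pwDl// mulr_ge0// ltW.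
have auc := classPD_continuous auPD.
(* Absolute values extend the functions off the half line. The free [h] serves both joint continuity
   and continuity in [r] at a fixed time. *)
have cG (h : R * R -> R) : continuous h -> (forall p, 0 <= h p) -> 
    continuous (fun p : R * R => decay_bound au nu `|p.1| (h p)).
  move=> ch h0 p; have cA : au `|q.1| @[q --> p] --> au `|p.1|.
    apply: (@continuous_comp _ _ _ fst (fun s : R => au `|s|)); last exact: auc.
    exact: cvg_fst.
  apply: cvgM.
    apply: cvgD => //; apply: cvgM; first exact: cvg_cst.
    by rewrite expr2; under eq_fun do rewrite expr2; exact: cvgM.
  apply: cvgV; first by rewrite gt_eqF// den.
  apply: cvgD; first exact: cvg_cst.
  apply: cvgM; first exact: ch.
  by apply: (@continuous_comp _ _ _ (fun q : R * R => au `|q.1|) nu); [exact: cA|exact: cnu].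
have num_ge0 r : 0 <= r -> 0 <= 2 * au r ^+ 2 + au r.
  by move=> r0; rewrite addr_ge0 ?mulr_ge0 ?sqr_ge0// classPD_ge0.
split.
- apply: (@subspace_eq_continuous _ _ _ (fun p : R * R => decay_bound au nu `|p.1| `|p.2|)).
    by move=> p; rewrite inE/= => -[p1 p2]; rewrite !ger0_norm.
  apply: continuous_subspaceT; apply: cG => // p.
  apply: (@continuous_comp _ _ _ snd (fun x : R => `|x|)); last exact: norm_continuous.
  exact: cvg_snd.
- move=> s s0; split; first split.
  + apply: (@subspace_eq_continuous _ _ _ (fun r : R => decay_bound au nu `|r| s)).
      by move=> r; rewrite inE/= in_itv/= andbT => r0; rewrite ger0_norm.
    apply: continuous_subspaceT => r.
    apply: (@continuous_comp _ _ _ (fun r : R => (r, s))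
      (fun p : R * R => decay_bound au nu `|p.1| s)).
      exact: (cvg_pair cvg_id (cvg_cst s)).
    by apply: cG => // q; exact: cvg_cst.
  + by rewrite /decay_bound au0 expr0n mulr0 addr0 mul0r.
  + move=> r r0; have aur := au_gt0 r r0.
    by rewrite /decay_bound divr_gt0 ?den// addr_gt0// mulr_gt0// exprn_gt0.
  + move=> r r'; rewrite !in_itv/= !andbT => r0 r'0 rr'.
    have auL : au r < au r' by apply: au_mono; rewrite ?in_itv/= ?andbT.
    have aur := classPD_ge0 auPD r0.
    apply: (@lt_le_trans _ _ ((2 * au r' ^+ 2 + au r') / (1 + s * nu (au r)))).
      by rewrite ltr_pM2r ?invr_gt0 ?den// !expr2; nra.
    rewrite ler_wpM2l ?num_ge0// lef_pV2 ?posrE ?den//.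
    by rewrite lerD2l ler_wpM2l// nu_mono// ltW.
- move=> r r0 s t; rewrite !in_itv/= !andbT => s0 t0 ts.
  rewrite ler_wpM2l ?num_ge0// lef_pV2 ?posrE ?den//.
  by rewrite lerD2l ler_wpM2r// ltW.
- move=> r r0; set N := 2 * au r ^+ 2 + au r; have N0 : 0 <= N := num_ge0 r r0.
  have nur := nu_gt0 (au r).
  apply/cvgrPdist_lt => e e0; near=> t.
  have t0 : 0 < t by near: t; exact: nbhs_pinfty_gt.
  rewrite sub0r normrN /decay_bound -/N ger0_norm ?divr_ge0 ?(ltW (den _ _ (ltW t0)))//.
  rewrite ltr_pdivrMr ?den ?(ltW t0)//.
  have : N / e / nu (au r) < t by near: t; apply: nbhs_pinfty_gt; exact: num_real.
  rewrite ltr_pdivrMr// ltr_pdivrMr// => h; apply: lt_trans h _.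
  by rewrite (mulrC e) ltr_pM2r// ltrDr.
Unshelve. all: by end_near. Qed.

End OutputGains.

(** * The dual-rate closed loop *)

Section ClosedLoop.
Context {R : realType} {n m p : nat}.
Variable f : 'rV[R]_n -> 'rV[R]_m -> 'rV[R]_p -> 'rV[R]_n.
Variable Fa : forall T h : R, 'rV[R]_n -> 'rV[R]_m -> segment (p := p) T -> 'rV[R]_n.
Arguments Fa : clear implicits.
Variable uc : R -> R -> 'rV[R]_n -> 'rV[R]_m.
Variables (l : nat) (l0 : (0 < l)%N) (T h : R) (T0 : 0 < T).
Variables (Dw X L K C eta : R).
Hypotheses (Dw0 : 0 <= Dw) (X0 : 0 <= X) (L0 : 0 <= L) (K0 : 0 <= K) (C0 : 0 <= C).
Hypotheses (eta1 : eta <= 1) (lTC : l%:R * (T * (2 * C + 1)) <= 1).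

(** The plant hypotheses below range over such signals because they are used with the actual
    disturbance and with the zero disturbance of the predictor. *)
Definition bounded_signal (v : R -> 'rV[R]_p) :=
  Linf v /\ forall t, 0 <= t -> enorm (v t) <= Dw.

Let c : R := n%:R + 1.
Let D := c * (X + 1).

Hypothesis uc_lip : forall x1 x2, Num.max (enorm x1) (enorm x2) <= D ->
  enorm (uc T h x2 - uc T h x1) <= L * enorm (x2 - x1).
Hypothesis uc0 : uc T h 0 = 0.
Hypothesis Fe_exists : forall v k (x : 'rV[R]_n) (u : 'rV[R]_m),
  bounded_signal v -> `|x| <= X + 1 -> `|u| <= L * D ->
  exists y, exact_model f T x u v k y.
Hypothesis Fe_near : forall v k (x : 'rV[R]_n) (u : 'rV[R]_m) y,
  bounded_signal v -> `|x| <= X + 1 -> `|u| <= L * D ->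
  exact_model f T x u v k y -> `|y - x| <= C * T.
Hypothesis Fe_input : forall v k (x : 'rV[R]_n) (u1 u2 : 'rV[R]_m) y1 y2,
  bounded_signal v -> `|x| <= X + 1 -> `|u1| <= L * D -> `|u2| <= L * D ->
  exact_model f T x u1 v k y1 -> exact_model f T x u2 v k y2 ->
  `|y1 - y2| <= 2 * (K * `|u1 - u2|) * T.
Hypothesis Fa_consistent : forall v k (x : 'rV[R]_n) (u : 'rV[R]_m) y,
  bounded_signal v -> enorm x <= D -> enorm u <= L * D ->
  exact_model f T x u v k y ->
  enorm (y - Fa T h x u (on_period T v k)) <= T * eta.

Let c1 : 1 <= c. Proof. by rewrite /c lerDr. Qed.
Let c0 : 0 <= c. Proof. exact: le_trans c1. Qed.
Let D0 : 0 <= D. Proof. by rewrite mulr_ge0// addr_ge0. Qed.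
Let C1 : 1 <= 2 * C + 1. Proof. by rewrite lerDr mulr_ge0. Qed.
Let l1 : 1 <= l%:R :> R. Proof. by rewrite ler1n. Qed.

Let TC1 : T * (2 * C + 1) <= 1.
Proof.
apply: le_trans lTC; rewrite ler_peMl// mulr_ge0 ?(ltW T0)//.
by move: C1; lra.
Qed.

Let enorm_le_D (x : 'rV[R]_n) : `|x| <= X + 1 -> enorm x <= D.
Proof. by move=> xX; rewrite (le_trans (enorm_le_norm x))// ler_wpM2l. Qed.

Let norm_le_X1 (x : 'rV[R]_n) : enorm x <= X -> `|x| <= X + 1.
Proof. by move=> xX; rewrite (le_trans (norm_le_enorm x))// (le_trans xX)// lerDl. Qed.

Lemma control_le (x : 'rV[R]_n) : `|x| <= X + 1 -> enorm (uc T h x) <= L * D.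
Proof.
move=> /enorm_le_D xD.
have := @uc_lip 0 x; rewrite uc0 !subr0 enorm0 => h0.
rewrite (le_trans (h0 _))//; last by rewrite ler_wpM2l.
by rewrite ge_max D0.
Qed.

Let control_norm_le (x : 'rV[R]_n) : `|x| <= X + 1 -> `|uc T h x| <= L * D.
Proof. by move=> /control_le; apply: le_trans; exact: norm_le_enorm. Qed.

Lemma bounded_signal0 : bounded_signal (fun=> 0).
Proof. by split; [exact: Linf0|move=> t _; rewrite enorm0]. Qed.

Variables (w : R -> 'rV[R]_p) (wb : bounded_signal w) (x : nat -> 'rV[R]_n).
Let xc := controller_state Fa uc l T h x.

Let controller_norm_le k : enorm (x k) <= X ->
  `|xc k - x k| <= (k %% l)%:R * (T * (2 * C + 1)) -> `|xc k| <= X + 1.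
Proof.
move=> xX err.
have : `|xc k| <= `|xc k - x k| + `|x k| by rewrite -{1}(subrK (x k) (xc k)) ler_normD.
have : `|x k| <= X by rewrite (le_trans (norm_le_enorm _)).
have : (k %% l)%:R * (T * (2 * C + 1)) <= 1.
  apply: le_trans lTC; rewrite ler_wpM2r ?ler_nat ?(ltnW (ltn_pmod k l0))//.
  by rewrite mulr_ge0 ?(ltW T0)//; move: C1; lra.
lra.
Qed.

(** In one step the plant state moves by at most [C * T], the exact model started at the predicted
    state moves by as much, and consistency adds [T * eta <= T]. The error thus grows by
    [T * (2 * C + 1)] per step and is reset at each measurement. *)
Lemma controller_error k :
  (forall j, (j < k)%N -> exact_model f T (x j) (uc T h (xc j)) w j (x j.+1)) ->
  (forall j, (j <= k)%N -> enorm (x j) <= X) ->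
  `|xc k - x k| <= (k %% l)%:R * (T * (2 * C + 1)).
Proof.
elim: k => [|k IHk] ex xX; first by rewrite subrr normr0 mod0n mul0r.
have IH : `|xc k - x k| <= (k %% l)%:R * (T * (2 * C + 1)).
  by apply: IHk => j jk; [apply: ex; exact: ltnW|apply: xX; exact: leqW].
rewrite /xc /=; case: ifPn => [/eqP ->|ndvd]; first by rewrite subrr normr0 mul0r.
rewrite -/(xc k).
have kS : (k.+1 %% l = (k %% l).+1)%N.
  move: ndvd; rewrite /dvdn -addn1 -modnDml addn1; have := ltn_pmod k l0.
  rewrite leq_eqVlt => /predU1P[->|kl]; first by rewrite modnn.
  by rewrite modn_small.
have xk1 : `|x k| <= X + 1 by apply: norm_le_X1; exact: xX.
have xck1 : `|xc k| <= X + 1 by apply: controller_norm_le IH; exact: xX.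
have uck := control_norm_le xck1.
(* Consistency compares [Fa] only with existing exact values, so the undisturbed exact step from the
   predicted state is produced here. *)
have [y yP] := Fe_exists k bounded_signal0 xck1 uck.
have e1 := Fe_near bounded_signal0 xck1 uck yP.
have e2 := Fe_near wb xk1 uck (ex k (ltnSn k)).
have e3 := Fa_consistent bounded_signal0 (enorm_le_D xck1) (control_le xck1) yP.
have {}e3 := le_trans (norm_le_enorm _) e3.
set z := Fa _ _ _ _ _ in e3 *.
have : `|z - x k.+1| <= `|y - z| + `|y - xc k| + `|xc k - x k| + `|x k.+1 - x k|.
  rewrite (_ : z - x k.+1 = - (y - z) + (y - xc k) + (xc k - x k) - (x k.+1 - x k)).
    rewrite (le_trans (ler_normB _ _))// lerD2r.
    rewrite (le_trans (ler_normD _ _))// lerD2r.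
    by rewrite (le_trans (ler_normD _ _))// normrN.
  by apply/rowP => i; rewrite !mxE; ring.
rewrite kS -(natr1 (k %% l)).
have : T * eta <= T by rewrite ler_piMr// ltW.
lra.
Qed.

Lemma next_state_exists k :
  (forall j, (j < k)%N -> exact_model f T (x j) (uc T h (xc j)) w j (x j.+1)) ->
  (forall j, (j <= k)%N -> enorm (x j) <= X) ->
  exists y, exact_model f T (x k) (uc T h (xc k)) w k y.
Proof.
move=> ex xX; have xkX := xX k (leqnn k).
apply: Fe_exists => //; first exact: norm_le_X1.
by apply/control_norm_le/controller_norm_le => //; exact: controller_error.
Qed.

(** The intermediate point is the exact step from [x k] under the single-rate input. It differs from
    [x k.+1] only through the input, hence by O(T^2), and from [z] by the consistency error. The
    other two bounds put both points in the ball where V will be Lipschitz. *)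
Lemma step_error k :
  (forall j, (j <= k)%N -> exact_model f T (x j) (uc T h (xc j)) w j (x j.+1)) ->
  (forall j, (j <= k)%N -> enorm (x j) <= X) ->
  let z := single_rate_approx Fa uc T h (x k) (on_period T w k) in
  [/\ enorm (x k.+1 - z) <= T * (c * (2 * K * L * c * (l%:R * (2 * C + 1)) * T + eta)),
      enorm (x k.+1) <= c * (X + 2) & enorm z <= c * (X + 2)].
Proof.
move=> ex xX z.
have xk1 : `|x k| <= X + 1 by apply: norm_le_X1; exact: xX.
have xkX : `|x k| <= X by rewrite (le_trans (norm_le_enorm _))// xX.
have err0 : `|xc k - x k| <= (k %% l)%:R * (T * (2 * C + 1)).
  by apply: controller_error => // j /ltnW; exact: ex.
have xck1 : `|xc k| <= X + 1 by apply: controller_norm_le err0; exact: xX.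
have err : `|xc k - x k| <= l%:R * (T * (2 * C + 1)).
  apply: le_trans err0 _; rewrite ler_wpM2r ?ler_nat ?(ltnW (ltn_pmod k l0))//.
  by rewrite mulr_ge0 ?(ltW T0)//; move: C1; lra.
have uck := control_norm_le xck1; have uk := control_norm_le xk1.
have [y yP] := Fe_exists k wb xk1 uk.
have e1 := Fe_near wb xk1 uk yP.
have e2 := Fe_near wb xk1 uck (ex k (leqnn k)).
have e3 := Fa_consistent wb (enorm_le_D xk1) (control_le xk1) yP.
have {}e3 := le_trans (norm_le_enorm _) e3.
rewrite -/(single_rate_approx Fa uc T h (x k) (on_period T w k)) -/z in e3.
have e4 := Fe_input wb xk1 uck uk (ex k (leqnn k)) yP.
have Teta : T * eta <= T by rewrite ler_piMr// ltW.
have TC : T * (2 * C + 1) = 2 * (C * T) + T by ring.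
have TC0 : 0 <= C * T by rewrite mulr_ge0// ltW.
have CT1 : C * T + T <= 1 by move: TC1; rewrite TC; lra.
have uerr : `|uc T h (xc k) - uc T h (x k)| <= L * (c * (l%:R * (T * (2 * C + 1)))).
  apply: le_trans (norm_le_enorm _) _.
  apply: le_trans (uc_lip _) _; first by rewrite ge_max !enorm_le_D.
  by rewrite ler_wpM2l// (le_trans (enorm_le_norm _))// ler_wpM2l.
split.
- apply: le_trans (enorm_le_norm _) _; rewrite -/c mulrCA ler_wpM2l//.
  have : `|x k.+1 - z| <= `|x k.+1 - y| + `|y - z| by exact: ler_distD.
  have : 2 * (K * `|uc T h (xc k) - uc T h (x k)|) * T <=
         2 * (K * (L * (c * (l%:R * (T * (2 * C + 1)))))) * T.
    by rewrite ler_wpM2r ?(ltW T0)// ler_wpM2l// ler_wpM2l.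
  lra.
- apply: le_trans (enorm_le_norm _) _; rewrite -/c ler_wpM2l//.
  have : `|x k.+1| <= `|x k.+1 - x k| + `|x k| by rewrite -{1}(subrK (x k) (x k.+1)) ler_normD.
  by move: T0; lra.
- apply: le_trans (enorm_le_norm _) _; rewrite -/c ler_wpM2l//.
  have : `|z - x k| <= `|z - y| + `|y - x k| by exact: ler_distD.
  have : `|z| <= `|z - x k| + `|x k| by rewrite -{1}(subrK (x k) z) ler_normD.
  by rewrite (distrC z y); move: T0; lra.
Qed.

End ClosedLoop.

(** * From local dissipation to the decay estimate *)

Section DissipationToDecay.
Context {R : realType}.
Variables (al au a nu1 nu2 : R -> R) (r y S : nat -> R) (N : nat).
Variables (T e d1 W X D1 : R).
Hypotheses (alK : classKoo al) (aPD : classPD a).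
Hypotheses (nu1_mono : {homo nu1 : c c' / c <= c'}) (nu1_01 : forall c, 0 <= nu1 c <= 1).
Hypotheses (nu2_mono : {homo nu2 : r r' /~ r <= r'}) (nu2_01 : forall r, 0 < nu2 r <= 1).
Hypothesis nu_le : forall s c r, 0 <= s -> c <= au s -> al s <= 2 * r -> nu1 c * nu2 r <= a s.
Hypotheses (T0 : 0 < T) (T1 : T <= 1) (e0 : 0 < e) (d1_ge0 : 0 <= d1) (d1e : 2 * d1 <= e).
Hypothesis d1_rate : 4 * d1 <= nu1 e * nu2 (Num.max (au (r 0%N)) (2 * e) + W).
Hypotheses (r_ge0 : forall j, 0 <= r j) (S00 : S 0%N = 0) (S_le : forall j, S j <= W).
Hypothesis S_mono : {homo S : i j / (i <= j)%N >-> i <= j}.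
Hypotheses (r0X : r 0%N <= X) (XD1 : X <= D1).
Hypothesis al_X : forall s, 0 <= s -> al s <= Num.max (au (r 0%N)) (2 * e) + W -> s <= X.
Hypothesis y_sandwich : forall j, (j <= N)%N -> r j <= D1 -> al (r j) <= y j <= au (r j).
Hypothesis dissipation : forall j, (j < N)%N -> (forall i, (i <= j)%N -> r i <= X) ->
  r j.+1 <= D1 /\ y j.+1 <= y j - T * a (r j) + (S j.+1 - S j) + T * (2 * d1).

Let z j := y j - S j.
Let zS j : z j + S j = y j. Proof. by rewrite subrK. Qed.

Let y0_le : y 0%N <= au (r 0%N).
Proof. by case/andP: (y_sandwich (leq0n N) (le_trans r0X XD1)). Qed.

(** [e <= z j] gives [e <= au (r j)], so [a (r j)] is at least the worst rate on the reachable
    annulus, hence at least [4 * d1]; the error [2 * d1] costs at most half of the decrease. *)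
Let z_step j : (j < N)%N -> (forall i, (i <= j)%N -> r i <= X) ->
  z j <= Num.max (au (r 0%N)) (2 * e) ->
  z j.+1 <= z j - T * a (r j) + T * (2 * d1) /\
  (e <= z j -> z j.+1 <= z j - T * a (r j) / 2).
Proof.
move=> jN rX zj; have [_ yS] := dissipation jN rX.
have dec : z j.+1 <= z j - T * a (r j) + T * (2 * d1) by rewrite /z; lra.
split=> // ez; have rjX := rX j (leqnn j).
have /andP[aly yau] := y_sandwich (ltnW jN) (le_trans rjX XD1).
have Sj : 0 <= S j by rewrite -S00; exact: S_mono.
have SW := S_le j.
have zy := zS j.
have rate : nu1 e * nu2 (Num.max (au (r 0%N)) (2 * e) + W) <= a (r j).
  apply: nu_le => //; first lra.
  have : 0 <= al (r j) by apply: (classPD_ge0 alK.1.1).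
  lra.
have : T * (4 * d1) <= T * a (r j).
  by rewrite ler_wpM2l ?(ltW T0)//; exact: le_trans rate.
lra.
Qed.

(** The two bounds go together because [dissipation] is available only while all earlier states are
    within [X]. Above [e] the sequence [z] does not grow, and from below [e] one step reaches at
    most [2 * e]. The radius [D1] makes [y_sandwich] applicable to the next state before it is known
    to lie within [X]. *)
Let invariant k : (k <= N)%N -> forall i, (i <= k)%N ->
  r i <= X /\ z i <= Num.max (au (r 0%N)) (2 * e).
Proof.
elim: k => [|k IHk] kN i.
  rewrite leqn0 => /eqP ->; split => //.
  by rewrite /z S00 subr0 le_max y0_le.
have {}IHk := IHk (ltnW kN).
rewrite leq_eqVlt => /predU1P[->|]; last exact: IHk.
have rX j : (j <= k)%N -> r j <= X by move=> /IHk[].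
have [_ zk] := IHk k (leqnn k).
have [zk1 zk2] := z_step kN rX zk.
have [rk1 _] := dissipation kN rX.
have ark : 0 <= T * a (r k).
  by rewrite mulr_ge0 ?(ltW T0)//; exact: (classPD_ge0 aPD).
have Td : T * (2 * d1) <= e.
  by rewrite (le_trans _ d1e)// ler_piMl// mulr_ge0.
have zk1' : z k.+1 <= Num.max (au (r 0%N)) (2 * e).
  have [ez|ze] := leP e (z k); first by apply: le_trans zk; have := zk2 ez; lra.
  by rewrite le_max; apply/orP; right; lra.
split=> //; apply: al_X => //.
have /andP[aly _] := y_sandwich kN rk1; apply: le_trans aly _.
have := zS k.+1; have := S_le k.+1; lra.
Qed.

Lemma dissipation_to_decay k : (k <= N)%N ->
  r k <= X /\
  al (r k) / 2 * nu1 (al (r k) / 2) <=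
    decay_bound au nu2 (r 0%N) (k%:R * T) + S k + 2 * e.
Proof.
move=> kN; have inv := invariant (leqnn N).
have [rkX _] := inv k kN; split=> //.
have rX j : (j <= N)%N -> r j <= X by move=> /inv[].
have steps j : (j < N)%N -> z j.+1 <= z j - T * a (r j) + T * (2 * d1) /\
    (e <= z j -> z j.+1 <= z j - T * a (r j) / 2).
  move=> jN; apply: z_step => //; last by case: (inv j (ltnW jN)).
  by move=> i ij; apply: rX; exact: leq_trans (ltnW jN).
have sand j : (j <= N)%N -> al (r j) <= y j <= au (r j).
  by move=> jN; apply: y_sandwich => //; exact: le_trans (rX j jN) XD1.
have al_ge0 j : 0 <= al (r j) by apply: (classPD_ge0 alK.1.1).
have y_ge0 j : (j <= N)%N -> 0 <= y j.
  by move=> /sand/andP[+ _]; exact: le_trans.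
have S_ge0 j : 0 <= S j by rewrite -S00; exact: S_mono.
have Td : T * (2 * d1) <= e.
  by rewrite (le_trans _ d1e)// ler_piMl// mulr_ge0.
have z00 : 0 <= z 0%N by rewrite /z S00 subr0 y_ge0.
have /andP[alyk _] := sand k kN.
have := @practical_decay R z S e N e0 nu1 nu2 T nu1_mono nu1_01 nu2_01 T0 z00 S_ge0 S_mono.
move=> /(_ _ _ _ k kN) main.
apply: (@le_trans _ _ ((z k + S k) / 2 * nu1 ((z k + S k) / 2))).
  have ak := al_ge0 k; rewrite zS; apply: ler_pM; rewrite ?divr_ge0//; last first.
  - by apply: nu1_mono; lra.
  - lra.
  - by case/andP: (nu1_01 (al (r k) / 2)).
apply: le_trans (main _ _ _) _.
- by move=> j jN; rewrite zS y_ge0.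
- move=> j jN; have [zj _] := steps j jN.
  have : 0 <= T * a (r j) by rewrite mulr_ge0 ?(ltW T0)//; exact: (classPD_ge0 aPD).
  lra.
- move=> j c rr jN ez; rewrite zS => cy yr; have [_ /(_ ez) zj] := steps j jN.
  have /andP[aly yau] := sand j (ltnW jN).
  apply: le_trans zj _; rewrite lerD2l lerN2 ler_wpM2r// ler_wpM2l ?(ltW T0)//.
  apply: nu_le => //; first exact: le_trans yau.
  exact: le_trans yr.
rewrite lerD2r lerD2r /decay_bound.
have zau : z 0%N <= au (r 0%N) by rewrite /z S00 subr0 y0_le.
have den s : 0 < 1 + k%:R * T * nu2 s.
  by rewrite ltr_pwDl// !mulr_ge0// ltW//; case/andP: (nu2_01 s).
(* Replacing [z 0] by the larger [au (r 0)] enlarges the numerator and, [nu2] being nonincreasing,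
   shrinks the denominator. *)
apply: (@le_trans _ _ ((2 * au (r 0%N) ^+ 2 + au (r 0%N)) / (1 + k%:R * T * nu2 (z 0%N)))).
  rewrite ler_wpM2r ?invr_ge0 ?(ltW (den _))// !expr2; nra.
rewrite ler_wpM2l//.
  by rewrite addr_ge0 ?mulr_ge0 ?exprn_ge0//; exact: le_trans zau.
rewrite lef_pV2 ?posrE ?den// lerD2l ler_wpM2l ?nu2_mono//.
by rewrite mulr_ge0// ltW.
Qed.

End DissipationToDecay.

(** * Existence of dual-rate trajectories *)

Section Trajectories.
Context {R : realType} {n m p : nat}.
Variable f : 'rV[R]_n -> 'rV[R]_m -> 'rV[R]_p -> 'rV[R]_n.
Variable Fa : forall T h : R, 'rV[R]_n -> 'rV[R]_m -> segment (p := p) T -> 'rV[R]_n.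
Arguments Fa : clear implicits.
Variable uc : R -> R -> 'rV[R]_n -> 'rV[R]_m.
Variables (l : nat) (T h : R) (w : R -> 'rV[R]_p) (x0 : 'rV[R]_n).

Definition trajectory_upto (N : nat) (x : nat -> 'rV[R]_n) := forall j, (j < N)%N ->
  exact_model f T (x j) (uc T h (controller_state Fa uc l T h x j)) w j (x j.+1).

(** Plant and controller states are built jointly, since the next plant state needs the current
    controller state while [controller_state] takes a whole plant sequence. The default 0 of [xget]
    is not reached once a next state is known to exist. *)
Fixpoint plant_controller (k : nat) : 'rV[R]_n * 'rV[R]_n :=
  if k is j.+1 then
    let: (xj, xcj) := plant_controller j in
    let y := xget 0 [set y | exact_model f T xj (uc T h xcj) w j y] in
    (y, if (l %| k)%N then y else Fa T h xcj (uc T h xcj) (on_period T (fun=> 0) j))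
  else (x0, x0).

Lemma dual_rate_trajectory :
  (forall N x, x 0%N = x0 -> trajectory_upto N x ->
     exists y, exact_model f T (x N) (uc T h (controller_state Fa uc l T h x N)) w N y) ->
  exists2 x, dual_rate_exact f Fa uc l T h w x & x 0%N = x0.
Proof.
move=> ext; pose x k := (plant_controller k).1; exists x => //.
have xcE k : controller_state Fa uc l T h x k = (plant_controller k).2.
  elim: k => [//|k IHk]; rewrite /= IHk /x /=.
  by case: (plant_controller k) => xk xck /=; case: ifP.
suff all N : trajectory_upto N x by move=> k; exact: (all k.+1).
elim: N => [//|N IHN] j; rewrite ltnS leq_eqVlt => /predU1P[->|]; last exact: IHN.
have := ext N x erefl IHN; rewrite xcE /x /=.
case: (plant_controller N) => xN xcN /= exN.
by have := xgetPex 0 exN.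
Qed.

End Trajectories.

(** * Choice of the constants and conclusion *)

Unset Implicit Arguments.

Theorem theorem7 (R : realType) (n m p : nat)
    (f : 'rV[R]_n -> 'rV[R]_m -> 'rV[R]_p -> 'rV[R]_n)
    (l : nat)
    (Fa : forall T h : R, 'rV[R]_n -> 'rV[R]_m -> @segment R p T -> 'rV[R]_n)
    (uc : R -> R -> 'rV[R]_n -> 'rV[R]_m)
    (f_lip : locally_lipschitz_field f)
    (f_0 : f 0 0 0 = 0)
    (l_ge1 : (1 <= l)%N)
    (uc_0 : forall T h : R, 0 < T -> 0 < h -> uc T h 0 = 0) :
  lyapunov_SP_iISS (single_rate_approx Fa uc) ->
  one_step_consistent f Fa ->
  uniformly_locally_lipschitz uc ->
  SP_iISS (dual_rate_exact f Fa uc l).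
Proof.
move=> [al [au [a [g [alK auK aPD gK lyap]]]]] cons ulip.
have [nu1 [nu2 [[cnu1 nu1_mono nu1_01 nu1_gt0] [cnu2 nu2_mono nu2_01] nu_le]]] :=
  decay_rate alK auK aPD.
exists (fun s => al s / 2 * nu1 (al s / 2)), (decay_bound au nu2), g.
split; [exact: classKoo_mul_rate|exact: decay_bound_classKL|exact: gK|].
move=> Dx Dw1 Dw2 d Dx0 Dw10 Dw20 d0.
(* The decay estimate loses [2 * e]. Below, [Y] bounds V along trajectories: the maximum bounds [z],
   and [Dw2] the accumulated gain. *)
pose e := d / 2; have e0 : 0 < e by rewrite divr_gt0.
pose Y := Num.max (au Dx) (2 * e) + Dw2.
have [X' X'0 X'Y] := classKoo_large (Y + 1) alK.
pose X := Num.max X' Dx.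
have XX' : X' <= X by rewrite /X le_max lexx.
have XDx : Dx <= X by rewrite /X le_max lexx orbT.
have X0 : 0 < X by exact: lt_le_trans XX'.
have al_X s : al s <= Y -> s <= X.
  move=> sY; rewrite leNgt; apply/negP => Xs.
  by have := X'Y s (le_trans XX' (ltW Xs)); lra.
pose c : R := n%:R + 1; have c1 : 1 <= c by rewrite lerDr.
have c0 : 0 < c by exact: lt_le_trans c1.
(* Predicted states stay in the sup-norm ball of radius [X + 1], hence in the Euclidean ball of
   radius [D]; one step of either loop stays within [c * (X + 2)]. *)
pose D := c * (X + 1); have D0 : 0 < D by rewrite mulr_gt0// addr_gt0.
have XcX2 : X <= c * (X + 2).
  rewrite (@le_trans _ _ (X + 2))// ?lerDl// ler_peMl// addr_ge0//; exact: ltW.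
have D10 : 0 < c * (X + 2) by rewrite mulr_gt0// addr_gt0.
have [Tu [L [Tu0 L0 ulipT]]] := ulip D D0.
pose U := L * D; have U0 : 0 < U by rewrite mulr_gt0.
(* Half of [B] covers the states, which leaves solutions room to move during a period; the other
   terms cover inputs and disturbances. *)
pose B := 2 * (X + 1) + U + Dw1.
have B0 : 0 < B by rewrite /B; lra.
have [K K0 [f_K f_B]] := field_lipschitz f_lip B f_0.
pose C := K * B; have C0 : 0 < C by rewrite mulr_gt0.
have [rho rhoK [Tc Tc0 consT]] := cons D U Dw1.
(* Two errors [d1] arise, one from the Lyapunov inequality and one from passing to the exact loop.
   [4 * d1] must not exceed the slowest rate while [z >= e], nor [e] itself. *)
pose d1 := Num.min (nu1 e * nu2 Y) e / 4.
have d10 : 0 < d1.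
  rewrite /d1 divr_gt0// lt_min e0 andbT mulr_gt0 ?nu1_gt0//.
  by case/andP: (nu2_01 Y).
have [Tv [M [Tv0 M0 lyapT]]] := lyap (c * (X + 2)) Dw1 Dw2 d1 D10 Dw10 Dw20 d10.
pose q := l%:R * (2 * C + 1).
have l1 : 1 <= l%:R :> R by rewrite ler1n.
have q1 : 1 <= q.
  by rewrite /q -[leLHS]mulr1 ler_pM// lerDr mulr_ge0// ltW.
pose E := 2 * K * L * c * q.
have q0 : 0 < q by exact: lt_le_trans q1.
have E0 : 0 < E by rewrite (pmulr_lgt0 _ q0) !mulr_gt0.
(* Solves [M * c * (2 * eps) = d1]: one [eps] pays for the sampling drift [E * T], the other for
   [rho h]. *)
pose eps := d1 / (2 * M * c).
have eps0 : 0 < eps by rewrite divr_gt0// !mulr_gt0.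
(* [1 / (4 * K)] confines solutions to the ball of radius [B], [1 / q] keeps the predictor error
   within 1, [eps / E] limits the sampling drift, and the initial 1 makes errors per step no larger
   than errors per unit time. *)
pose Ts := \big[Num.min/1]_(r <- [:: Tu; Tc; Tv; 1 / (4 * K); 1 / q; eps / E]) r.
have Ts0 : 0 < Ts.
  have q0' : 0 < 1 / q by rewrite divr_gt0.
  have K0' : 0 < 1 / (4 * K) by rewrite divr_gt0// mulr_gt0.
  have eE : 0 < eps / E by rewrite divr_gt0.
  by rewrite /Ts !big_cons big_nil !lt_min Tu0 Tc0 Tv0 ltr01 q0' K0' eE.
exists Ts => // T /andP[T0]; rewrite /Ts !big_cons big_nil !lt_min.
move=> /and5P[TTu TTc TTv TK /and3P[Tq TE T1]].
have [hu /andP[hu0 huT] ulip'] := ulipT T (introT andP (conj T0 TTu)).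
have [hc /andP[hc0 hcT] cons'] := consT T (introT andP (conj T0 TTc)).
have [hv /andP[hv0 hvT] lyap'] := lyapT T (introT andP (conj T0 TTv)).
(* [rho h <= 1] is for the predictor error, [rho h <= eps] for the dissipation inequality. *)
have m0 : 0 < Num.min 1 eps by rewrite lt_min ltr01.
have [hr hr0 rho_small] := classPD_small rhoK.1.1 m0.
exists (Num.min (Num.min hu hc) (Num.min hv hr)).
  by rewrite !lt_min hu0 hc0 hv0 hr0/= !ge_min huT.
move=> w x0 h wD wg x0D /andP[h0]; rewrite !lt_min.
move=> /andP[/andP[hhu hhc] /andP[hhv hhr]].
have := rho_small h (introT andP (conj h0 hhr)); rewrite le_min => /andP[eta1 etae].
have uc_lip := ulip' h (introT andP (conj h0 hhu)).
have [V [_ V0 VF V_lip]] := lyap' h (introT andP (conj h0 hhv)).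
have KT : K * T <= 1 / 4.
  rewrite ler_pdivlMr// (_ : K * T * 4 = T * (4 * K)); last by ring.
  by move: TK; rewrite ltr_pdivlMr ?mulr_gt0// => /ltW.
have lTC : l%:R * (T * (2 * C + 1)) <= 1.
  by rewrite mulrCA -/q; move: Tq; rewrite ltr_pdivlMr//; exact: ltW.
have wb : bounded_signal Dw1 w.
  by split; [exact: Linf_lt_Linf wD|move=> t t0; apply/ltW/(Linf_lt_bound wD)].
have vB (v : R -> 'rV[R]_p) t : bounded_signal Dw1 v -> 0 <= t -> `|v t| <= B.
  move=> [_ vD] t0; rewrite (le_trans (norm_le_enorm _))// (le_trans (vD t t0))//.
  by rewrite /B lerDr addr_ge0 ?(ltW U0)// mulr_ge0// addr_ge0// ltW.
have xB (x : 'rV[R]_n) : `|x| <= X + 1 -> `|x| <= B / 2.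
  move=> xX; rewrite (le_trans xX)// ler_pdivlMr// mulrC /B -addrA lerDl.
  by rewrite addr_ge0 ?(ltW U0) ?(ltW Dw10).
have uB (u : 'rV[R]_m) : `|u| <= L * D -> `|u| <= B.
  move=> uU; rewrite (le_trans uU)// /B addrAC lerDr.
  by rewrite addr_ge0 ?(ltW Dw10)// mulr_ge0// addr_ge0// ltW.
have Fe_exists v k (x : 'rV[R]_n) (u : 'rV[R]_m) : bounded_signal Dw1 v ->
    `|x| <= X + 1 -> `|u| <= L * D -> exists y, exact_model f T x u v k y.
  move=> vb xX uU; apply: (exact_model_exists f_lip B0 K0 f_K f_B T0 KT vb.1.1).
  - by move=> t; exact: vB.
  - exact: xB.
  - exact: uB.
have Fe_near v k (x : 'rV[R]_n) (u : 'rV[R]_m) y : bounded_signal Dw1 v ->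
    `|x| <= X + 1 -> `|u| <= L * D -> exact_model f T x u v k y -> `|y - x| <= C * T.
  move=> vb xX uU; apply: (exact_model_near B0 K0 f_B T0 KT).
  - by move=> t; exact: vB.
  - exact: xB.
  - exact: uB.
have Fe_input v k (x : 'rV[R]_n) (u1 u2 : 'rV[R]_m) y1 y2 : bounded_signal Dw1 v ->
    `|x| <= X + 1 -> `|u1| <= L * D -> `|u2| <= L * D ->
    exact_model f T x u1 v k y1 -> exact_model f T x u2 v k y2 ->
    `|y1 - y2| <= 2 * (K * `|u1 - u2|) * T.
  move=> vb xX uU1 uU2; apply: (exact_model_input B0 K0 f_K f_B T0 KT).
  - by move=> t; exact: vB.
  - exact: xB.
  - exact: uB.
  - exact: uB.
have Fa_cons v k (x : 'rV[R]_n) (u : 'rV[R]_m) y : bounded_signal Dw1 v ->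
    enorm x <= D -> enorm u <= L * D -> exact_model f T x u v k y ->
    enorm (y - Fa T h x u (on_period T v k)) <= T * rho h.
  move=> vb xD uU; apply: cons' => //; [exact: vb.1| |by rewrite h0 hhc].
  apply: supnorm_le => t kt; apply: vb.2; exact: (period_ge0 (ltW T0) kt).
have uc0 : uc T h 0 = 0 by exact: uc_0.
have step := step_error l_ge1 T0 (ltW Dw10) (ltW X0) (ltW L0) (ltW K0) (ltW C0)
  eta1 lTC uc_lip uc0 Fe_exists Fe_near Fe_input Fa_cons wb.
have next := next_state_exists l_ge1 T0 (ltW Dw10) (ltW X0) (ltW L0) (ltW C0)
  eta1 lTC uc_lip uc0 Fe_exists Fe_near Fa_cons wb.
pose S j := gain_upto g w (j%:R * T).
have SS j : S j.+1 = S j + \int[completed_lebesgue_measure]_(s in period T j) g (enorm (w s)).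
  exact: (gain_uptoS gK wD j (ltW T0)).
have S_mono : {homo S : i j / (i <= j)%N >-> i <= j}.
  apply: homo_leq => [//|? ? ?|j]; first exact: le_trans.
  by rewrite SS lerDl; exact: gain_ge0.
have S_le j : S j <= Dw2 by apply: ltW; exact: (gain_upto_lt gK wD).
have S00 : S 0%N = 0 by rewrite /S mul0r (gain_upto0 gK wD).
(* Finite prefixes suffice and are needed: this bound is what makes the next state exist. *)
have prefix N x : x 0%N = x0 -> trajectory_upto f Fa uc l T h w N x ->
    forall k, (k <= N)%N -> enorm (x k) <= X /\
      al (enorm (x k)) / 2 * nu1 (al (enorm (x k)) / 2) <=
        decay_bound au nu2 (enorm (x 0%N)) (k%:R * T) + S k + 2 * e.
  move=> xx0 ex k kN.
  have x0Dx : enorm (x 0%N) <= Dx by rewrite xx0.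
  have Yle : Num.max (au (enorm (x 0%N))) (2 * e) + Dw2 <= Y.
    by rewrite lerD2r le_max2// (classK_le auK.1)// enorm_ge0.
  apply: (dissipation_to_decay (r := fun j => enorm (x j)) (y := fun j => V (x j))
    (S := S) (au := au) (a := a) (N := N) (d1 := d1) (W := Dw2) (D1 := c * (X + 2))
    alK aPD nu1_mono nu1_01 nu2_mono nu2_01 nu_le T0 (ltW T1) e0 (ltW d10)) => //.
  - have : 4 * d1 <= e by rewrite /d1 mulrC divfK// ge_min lexx orbT.
    by apply: le_trans; rewrite ler_wpM2r ?(ltW d10)// ler_nat.
  - rewrite /d1 mulrC divfK// ge_min; apply/orP; left.
    by rewrite ler_wpM2l ?nu2_mono//; case/andP: (nu1_01 e).
  - by move=> j; exact: enorm_ge0.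
  - exact: le_trans XDx.
  - by move=> s _ /le_trans/(_ Yle); exact: al_X.
  - by move=> j _ xj; have [] := VF (x j) w xj wD wg.
  - move=> j jN rX.
    have [] := step x j; [by move=> i ij; apply: ex; exact: leq_ltn_trans jN|exact: rX|].
    set zj := single_rate_approx _ _ _ _ _ _ => err xj1 zD; split=> //.
    have xjD : enorm (x j) <= c * (X + 2) by exact: le_trans (rX j (leqnn j)) XcX2.
    have [_ /(_ j)] := VF (x j) w xjD wD wg; rewrite -/zj => Vz.
    (* Both points lie in the ball where V is [M]-Lipschitz, and the step error carries the factor
       [T]. *)
    have Vx : V (x j.+1) - V zj <= T * d1.
      apply: le_trans (ler_norm _) _; apply: le_trans (V_lip _ _ _) _.
        by rewrite ge_max xj1 zD.
      apply: le_trans (ler_wpM2l (ltW M0) err) _; rewrite mulrCA ler_wpM2l ?(ltW T0)//.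
      have ETe : E * T <= eps.
        by move: TE; rewrite ltr_pdivlMr// mulrC => /ltW.
      rewrite (@le_trans _ _ (M * (c * (2 * eps))))//.
        rewrite ler_wpM2l ?(ltW M0)// ler_wpM2l ?(ltW c0)//.
        by rewrite -/c -/q -/E mulr_natl mulr2n lerD.
      rewrite /eps; have -> : M * (c * (2 * (d1 / (2 * M * c)))) = d1.
        by field; rewrite !gt_eqF.
      by [].
    have int_eq : T * (T^-1 * \int[completed_lebesgue_measure]_(s in period T j)
        g (enorm (w s))) = S j.+1 - S j.
      by rewrite mulVKf ?gt_eqF// SS addrC addKr.
    move: Vz Vx; rewrite !mulrDr int_eq mulrN (mulrCA _ 2).
    move: (V (x j.+1)) (V zj) (V (x j)) (T * a _) (S j.+1 - S j) (T * d1).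
    by clear; move=> *; lra.
have bound x k : dual_rate_exact f Fa uc l T h w x -> x 0%N = x0 ->
  al (enorm (x k)) / 2 * nu1 (al (enorm (x k)) / 2) <=
        decay_bound au nu2 (enorm (x 0%N)) (k%:R * T) + S k + d.
  move=> ex xx0; have [_] := @prefix k x xx0 (fun j _ => ex j) k (leqnn k).
  by rewrite /e (mulrC 2) divfK.
split; last by move=> x ex xx0 k; exact: bound.
apply: dual_rate_trajectory => N x xx0 ex; apply: next => // j jN.
by have [] := @prefix N x xx0 ex j jN.
Qed.
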